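(* Let $(Y,\mathscr{A},\mu)$ be a probability space, $T:Y\to Y$ a measurable map preserving $\mu$, $r\in L^1(Y,\mu)$ a real-valued function with $\inf r>0$, and $D\in\mathscr{A}$ with $\mu(D)>0$. Let $\varphi^t:X\to X$ ($t\ge0$) be the suspension semi-flow of $T$ with roof function $r$, let $\nu$ be its invariant probability measure on $X$, and for $x\in X$ let $P(x)=\sum_{t\in H(x,D)}\delta_t$ with $H(x,D)=\{t>0\mid\varphi^tx\in D\times\{0\}\}$. Let $\xi$ be the stationary extension to $\mathbb{R}$ of the point process $P(x)$, with $x\in X$ distributed according to $\nu$, and let $\eta$ be a point process distributed according to the Palm distribution $Q_\xi$ of $\xi$. Then, for every measurable $f:\mathcal{N}(\mathbb{R})\to\mathbb{R}_{\ge0}$ such that $f(\zeta)$ depends only on the restriction of $\zeta$ to $\mathbb{R}_{>0}$, $$\mathbb{E} f(\eta)=\frac1{\mu(D)}\int_D f(P(y,0))\,\mu(dy),$$ where $P(y,0)$ is viewed as an element of $\mathcal{N}(\mathbb{R})$ with no mass on $\mathbb{R}_{\le0}$.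
   Context: Suspension semi-flow: $X=\{(y,s)\mid y\in Y,\ 0\le s<r(y)\}$ (with the $\sigma$-algebra induced from the product $\sigma$-algebra on $Y\times\mathbb{R}_{\ge 0}$), $S_0(y)=0$, $S_n(y)=\sum_{j=0}^{n-1}r(T^jy)$ for $n\ge1$, and for $t\ge0$ $$\varphi^t(y,s)=(T^ny,\ s+t-S_n(y))\quad\text{if } S_n(y)\le s+t<S_{n+1}(y),\ n=0,1,2,\ldots.$$ The $\varphi^t$-invariant probability measure $\nu$ on $X$ is given by $\int_X f(x)\,\nu(dx)=\frac1{\overline r}\int_Y\big(\int_0^{r(y)}f((y,s))\,ds\big)\mu(dy)$ for measurable $f:X\to\mathbb{R}_{\ge0}$, where $\overline r=\int_Y r\,d\mu$. Point processes: $\mathcal{M}(\mathbb{R}_{>0})$ (resp. $\mathcal{M}(\mathbb{R})$) is the space of locally finite Borel measures on $\mathbb{R}_{>0}$ (resp. $\mathbb{R}$) with the vague topology, and $\mathcal{N}(\mathbb{R}_{>0})$ (resp. $\mathcal{N}(\mathbb{R})$) its subset of integer-valued measures (values in $\mathbb{Z}\cup\{\infty\}$ on Borel sets). A point process on $\mathbb{R}_{>0}$ (resp. $\mathbb{R}$) is a random measure in $\mathcal{N}(\mathbb{R}_{>0})$ (resp. $\mathcal{N}(\mathbb{R})$). Stationarity: the shift is $\theta^u\zeta B=\zeta(B+u)$ for Borel sets $B$ (with $u\ge0$, $B\subset\mathbb{R}_{>0}$ on $\mathcal{M}(\mathbb{R}_{>0})$; with $u\in\mathbb{R}$, $B\subset\mathbb{R}$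 on $\mathcal{M}(\mathbb{R})$). A random measure $\zeta$ is stationary if $\theta^u\zeta$ has the same distribution as $\zeta$ for all admissible $u$. The process $P(x)$, with $x$ distributed according to $\nu$, is stationary on $\mathbb{R}_{>0}$. The stationary extension of a stationary random measure $\zeta_0$ on $\mathbb{R}_{>0}$ is the limit in distribution in $\mathcal{M}(\mathbb{R})$ of $\theta^u\zeta_0$ as $u\to\infty$ (with $\zeta_0$ viewed as an element of $\mathcal{M}(\mathbb{R})$); it is a stationary random measure on $\mathbb{R}$ whose restriction to $\mathbb{R}_{>0}$ has the same distribution as $\zeta_0$. The intensity of a stationary random measure $\zeta$ is $I_\zeta=\mathbb{E}\,\zeta(0,R]/R$, independent of $R>0$. Palm distribution: for a stationary random measure $\xi$ on $\mathbb{R}$ with $0<I_\xi<\infty$, $Q_\xi$ is defined by $$Q_\xi f=\frac1{I_\xi\operatorname{Leb}B}\,\mathbb{E}\int_B f(\theta^u\xi)\,\xi(du)$$ for every measurable $f:\mathcal{M}(\mathbb{R})\to\mathbb{R}_{\ge0}$, where $B\subset\mathbb{R}$ is a Borel set with $0<\operatorname{Leb}B<\infty$ (the definition does not depend on $B$). That $\eta$ is distributed according to $Q_\xi$ means $\mathbb{E}f(\eta)=Q_\xi f$. If $\xi$ is a simple point process (all atoms of mass one, almost surely), then $\eta$ is a simple point process with $\eta\{0\}=1$ almost surely. *)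

(* Defs.v *)
From HB Require Import structures.
From mathcomp Require Import all_boot all_order all_algebra.
From mathcomp Require Import all_classical all_reals all_analysis measurable_realfun.

Set Implicit Arguments.
Unset Strict Implicit.
Unset Printing Implicit Defensive.
Import Order.TTheory GRing.Theory Num.Theory.
Import numFieldNormedType.Exports.

Local Open Scope classical_set_scope.
Local Open Scope ring_scope.

Section locally_finite_measures.
Context {R : realType}.

(* A library measure is defined on all sets of reals, with unconstrained values
   on the non-Borel ones. The vague topology, hence its Borel sigma-algebra,
   only sees the values on Borel sets, so these extra values are harmless. *)
Record lfmeasure := LFMeasure {
  lfm_measure :> {measure set (measurableTypeR R) -> \bar R} ;
  lfm_compact : forall K : set R, compact K -> (lfm_measure K < +oo)%E }.

HB.instance Definition _ := gen_eqMixin lfmeasure.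
HB.instance Definition _ := gen_choiceMixin lfmeasure.

Lemma mzero_compact (K : set R) : compact K ->
  ((mzero : {measure set (measurableTypeR R) -> \bar R}) K < +oo)%E.
Proof. by move=> _; exact: ltry. Qed.

HB.instance Definition _ := isPointed.Build lfmeasure (LFMeasure mzero_compact).

Record test_function := TestFunction {
  test_fun :> R -> R ;
  test_continuous : continuous test_fun ;
  test_compact : compact (closure [set x | test_fun x != 0]) }.

HB.instance Definition _ := gen_eqMixin test_function.
HB.instance Definition _ := gen_choiceMixin test_function.

Definition vague_pairing (zeta : lfmeasure) : {ptws test_function -> R} :=
  fun phi => \int[zeta]_x phi x.

HB.instance Definition _ :=
  Topological.copy lfmeasure (initial_topology vague_pairing).

(* the Borel sigma-algebra of the vague topology *)
HB.instance Definition _ :=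
  Measurable.copy lfmeasure (g_sigma_algebraType (@open lfmeasure)).

Definition integer_valued : set lfmeasure :=
  [set zeta | forall B, measurable B ->
    (exists n : nat, zeta B = n%:R%:E) \/ zeta B = +oo%E].

Definition intmeasure : Type := integer_valued.

Definition intmeasure_val (zeta : intmeasure) : lfmeasure := \val zeta.
Coercion intmeasure_val : intmeasure >-> lfmeasure.

Lemma mzero_integer_valued : LFMeasure mzero_compact \in integer_valued.
Proof. by rewrite inE => B mB; left; exists 0%N. Qed.

HB.instance Definition _ := Choice.on intmeasure.
HB.instance Definition _ := isPointed.Build intmeasure
  (exist (fun zeta => zeta \in integer_valued) _ mzero_integer_valued).
HB.instance Definition _ :=
  Measurable.copy intmeasure (g_sigma_algebra_preimageType intmeasure_val).

End locally_finite_measures.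
Arguments lfmeasure : clear implicits.
Arguments test_function : clear implicits.
Arguments intmeasure : clear implicits.

Section shift.
Context {R : realType}.
Local Open Scope ereal_scope.
Variables (u : R) (zeta : lfmeasure R).

Definition shift_fun (B : set (measurableTypeR R)) : \bar R :=
  zeta [set (b + u)%R | b in B].

Let shiftE (B : set R) :
  [set (b + u)%R | b in B] = (fun x : R => x - u)%R @^-1` B.
Proof.
apply/seteqP; split=> [_ [b Bb <-]|x Bx] /=; first by rewrite addrK.
by exists (x - u)%R => //; rewrite subrK.
Qed.

Let measurable_shift (B : set R) : measurable (B : set (measurableTypeR R)) ->
  measurable ([set (b + u)%R | b in B] : set (measurableTypeR R)).
Proof.
move=> mB; rewrite shiftE -[X in measurable X]setTI.
have mf : measurable_fun [set: R] (fun x : R => x - u)%R.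
  by apply: measurable_funD => //; exact: measurable_cst.
exact: mf.
Qed.

Let shift0 : shift_fun set0 = 0.
Proof. by rewrite /shift_fun image_set0 measure0. Qed.

Let shift_ge0 B : 0 <= shift_fun B.
Proof. by rewrite /shift_fun measure_ge0. Qed.

Let shift_sigma_additive : semi_sigma_additive shift_fun.
Proof.
move=> F mF tF mU; rewrite /shift_fun image_bigcup.
apply: measure_semi_sigma_additive.
- by move=> n; exact: measurable_shift.
- apply/trivIsetP => i j _ _ ij; rewrite !shiftE -preimage_setI.
  by move/trivIsetP : tF => /(_ _ _ Logic.I Logic.I ij) ->; rewrite preimage_set0.
- by rewrite -image_bigcup; exact: measurable_shift.
Qed.

HB.instance Definition _ := isMeasure.Build _ _ _ shift_fun
  shift0 shift_ge0 shift_sigma_additive.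

Lemma shift_compact (K : set R) : compact K -> shift_fun K < +oo.
Proof.
move=> cK; apply: lfm_compact; apply: continuous_compact => //.
apply: continuous_subspaceT => x; apply: cvgD; [exact: cvg_id|exact: cvg_cst].
Qed.

Definition shift_measure : lfmeasure R := LFMeasure shift_compact.

End shift.

Section dirac_sum.
Context {R : realType}.
Local Open Scope ereal_scope.
Variable H : set R.

Definition dirac_sum (B : set (measurableTypeR R)) : \bar R :=
  \esum_(t in H) \d_(t : measurableTypeR R) B.

Lemma dirac_sumE B : dirac_sum B = \esum_(t in H `&` B) 1.
Proof.
rewrite esum_mkcondr; apply: eq_esum => t _.
by rewrite diracE; case: (t \in B).
Qed.

Let dirac_sum0 : dirac_sum set0 = 0.
Proof. by rewrite dirac_sumE setI0 esum_set0. Qed.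

Let dirac_sum_ge0 B : 0 <= dirac_sum B.
Proof. by rewrite dirac_sumE; apply: esum_ge0. Qed.

Let dirac_sum_sigma_additive : semi_sigma_additive dirac_sum.
Proof.
move=> F _ tF _.
have -> : dirac_sum (\bigcup_n F n) = \sum_(0 <= i <oo) dirac_sum (F i).
  rewrite dirac_sumE setI_bigcupr nneseries_sum_bigcup//.
    by apply: eq_eseriesr => i _; rewrite dirac_sumE.
  apply/trivIsetP => i j _ _ ij; rewrite setIACA.
  by move/trivIsetP : tF => /(_ _ _ Logic.I Logic.I ij) ->; rewrite setI0.
by apply: is_cvg_nneseries.
Qed.

HB.instance Definition _ := isMeasure.Build _ _ _ dirac_sum
  dirac_sum0 dirac_sum_ge0 dirac_sum_sigma_additive.

Lemma dirac_sum_fin B : finite_set (H `&` B) ->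
  exists n : nat, dirac_sum B = n%:R%:E.
Proof. by move=> fHB; rewrite dirac_sumE finite_card_sum//; eexists. Qed.

Lemma dirac_sum_infin B : infinite_set (H `&` B) -> dirac_sum B = +oo.
Proof.
move=> iHB; rewrite dirac_sumE.
have <- := @infinite_card_dirac _ (measurableTypeR R) R _ iHB.
by apply: eq_esum => t Ht; rewrite diracE mem_set.
Qed.

End dirac_sum.

Section suspension.
Context {d : measure_display} {Y : measurableType d} {R : realType}.
Variables (T : Y -> Y) (r : Y -> R).

(* The sign condition on r makes the space nonempty, which measurable types
   are required to be. *)
Definition suspension (r_gt0 : 0 < inf (range r)) : Type :=
  {p : Y * measurableTypeR R | 0 <= p.2 < r p.1}.

Hypothesis r_gt0 : 0 < inf (range r).

Local Notation X := (suspension r_gt0).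

Lemma roof_ge y : inf (range r) <= r y.
Proof.
apply: ge_inf; last by exists y.
have [[]//|/inf_out ri] := pselect (has_inf (range r)).
by move: r_gt0; rewrite ri ltxx.
Qed.

Lemma roof_gt0 y : 0 < r y.
Proof. exact: lt_le_trans (roof_ge y). Qed.

Lemma base_subproof y : 0 <= (y, 0 : R).2 < r (y, 0 : R).1.
Proof. by rewrite /= lexx roof_gt0. Qed.

Definition base (y : Y) : X :=
  exist (fun p : Y * measurableTypeR R => 0 <= p.2 < r p.1) (y, 0) (base_subproof y).

HB.instance Definition _ := SubType.on X.
HB.instance Definition _ := Choice.on X.
HB.instance Definition _ := isPointed.Build X (base point).
HB.instance Definition _ := Measurable.copy X
  (g_sigma_algebra_preimageType (\val : X -> Y * measurableTypeR R)).

Definition birkhoff_sum (n : nat) (y : Y) : R := \sum_(j < n) r (iter j T y).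

(* For t >= 0 the default values of xget and insubd are not reached: see
   birkhoff_sum_ex and flowE. *)
Definition flow (t : R) (x : X) : X :=
  let y := (val x).1 in let s : R := (val x).2 in
  let n := xget 0%N
    [set n | birkhoff_sum n y <= s + t < birkhoff_sum n.+1 y] in
  insubd x (iter n T y, s + t - birkhoff_sum n y).

Definition hitting_times (D : set Y) (x : X) : set R :=
  [set t | 0 < t /\ (D `*` [set 0]) (val (flow t x))].

Lemma birkhoff_sumS n y :
  birkhoff_sum n.+1 y = birkhoff_sum n y + r (iter n T y).
Proof. exact: big_ord_recr. Qed.

Lemma birkhoff_sum_ge n y : inf (range r) *+ n <= birkhoff_sum n y.
Proof.
elim: n => [|n ih]; first by rewrite /birkhoff_sum big_ord0 mulr0n.
by rewrite birkhoff_sumS mulrSr lerD// roof_ge.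
Qed.

Lemma birkhoff_sum_le n m y : (n <= m)%N -> birkhoff_sum n y <= birkhoff_sum m y.
Proof.
elim: m => [|m ih]; first by rewrite leqn0 => /eqP ->.
rewrite leq_eqVlt => /predU1P[->//|/ih nm].
by rewrite birkhoff_sumS (le_trans nm)// lerDl ltW// roof_gt0.
Qed.

Lemma birkhoff_sum_uniq n m y (t : R) :
  birkhoff_sum n y <= t < birkhoff_sum n.+1 y ->
  birkhoff_sum m y <= t < birkhoff_sum m.+1 y -> n = m.
Proof.
move=> /andP[nt tn] /andP[mt tm]; apply/eqP; rewrite eqn_leq.
rewrite [(n <= m)%N]leqNgt [(m <= n)%N]leqNgt; apply/andP; split; apply/negP.
  by move=> /(birkhoff_sum_le y)/le_trans/(_ nt); rewrite leNgt tm.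
by move=> /(birkhoff_sum_le y)/le_trans/(_ mt); rewrite leNgt tn.
Qed.

Lemma birkhoff_sum_ex y (t : R) : 0 <= t ->
  exists n, birkhoff_sum n y <= t < birkhoff_sum n.+1 y.
Proof.
move=> t0.
have [n tn] : exists n, t < birkhoff_sum n y.
  exists (Num.truncn (t / inf (range r))).+1.
  apply: lt_le_trans (birkhoff_sum_ge _ _).
  by rewrite -mulr_natl -ltr_pdivrMr// truncnS_gt.
elim: n tn => [|n ih tn]; first by rewrite /birkhoff_sum big_ord0 ltNge t0.
have [/ih//|nt] := ltP t (birkhoff_sum n y).
by exists n; rewrite nt.
Qed.

Lemma flowE n (t : R) (x : X) :
  birkhoff_sum n (val x).1 <= ((val x).2 : R) + t < birkhoff_sum n.+1 (val x).1 ->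
  val (flow t x) = (iter n T (val x).1, ((val x).2 : R) + t - birkhoff_sum n (val x).1).
Proof.
move=> nP; rewrite /flow; case: xgetP => [m _ mP|/(_ n)//].
rewrite -(birkhoff_sum_uniq nP mP) val_insubd/=.
move: nP => /andP[nP1 nP2]; rewrite ifT//=.
by rewrite subr_ge0 nP1/= ltrBlDl -birkhoff_sumS.
Qed.

Lemma hitting_timesE (D : set Y) (x : X) (t : R) : hitting_times D x t ->
  exists n, t = birkhoff_sum n (val x).1 - ((val x).2 : R).
Proof.
move=> [t0 [_ /=]].
have x0 : 0 <= ((val x).2 : R) by case/andP: (valP x).
have [n nP] := birkhoff_sum_ex (val x).1 (addr_ge0 x0 (ltW t0)).
rewrite (flowE nP)/= => /eqP; rewrite subr_eq0 => /eqP xtE.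
by exists n; rewrite -xtE addrC addKr.
Qed.

Lemma hitting_times_finite (D : set Y) (x : X) (K : set R) :
  compact K -> finite_set (hitting_times D x `&` K).
Proof.
move=> /compact_bounded[M [_ /(_ (M + 1))]]; rewrite ltrDl ltr01 => /(_ isT) KM.
set y := (val x).1; set s : R := (val x).2.
pose N := (Num.truncn ((M + 1 + s) / inf (range r))).+1.
apply: (@sub_finite_set _ _ ((fun n => birkhoff_sum n y - s) @` `I_N)); last first.
  exact/finite_image/finite_II.
move=> t [/hitting_timesE[n tE] /KM /= tM]; exists n => //=.
rewrite ltnNge; apply/negP => Nn.
have : inf (range r) *+ N <= M + 1 + s.
  apply: (@le_trans _ _ (birkhoff_sum n y)).
    by apply: le_trans (birkhoff_sum_ge _ _); rewrite ler_wpMn2l// ltW.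
  by rewrite -lerBlDr -tE (le_trans (ler_norm _)).
by rewrite leNgt -mulr_natl -ltr_pdivrMr// truncnS_gt.
Qed.

Lemma hitting_process_compact (D : set Y) (x : X) (K : set R) :
  compact K -> (dirac_sum (hitting_times D x) K < +oo)%E.
Proof.
by move=> /(hitting_times_finite D x)/dirac_sum_fin[n ->]; exact: ltry.
Qed.

Lemma hitting_process_integer (D : set Y) (x : X) :
  LFMeasure (hitting_process_compact D x) \in integer_valued.
Proof.
rewrite inE => B _ /=.
have [/dirac_sum_fin|/dirac_sum_infin] := pselect (finite_set (hitting_times D x `&` B)).
  by left.
by right.
Qed.

Definition hitting_process (D : set Y) (x : X) : intmeasure R :=
  exist (fun zeta => zeta \in integer_valued) _ (hitting_process_integer D x).

Local Open Scope ereal_scope.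

(* insub (y, s) is the point (y, s) of the suspension when 0 <= s < r y *)
Definition is_suspension_measure
    (mu : {measure set Y -> \bar R}) (nu : {measure set X -> \bar R}) : Prop :=
  forall f : X -> R, measurable_fun [set: X] f -> (forall x, (0 <= f x)%R) ->
  \int[nu]_x (f x)%:E = (\int[mu]_y (r y)%:E)^-1 *
    \int[mu]_y \int[lebesgue_measure]_(s in `[0%R, r y[)
      oapp (fun x : X => (f x)%:E) 0 (insub (y, s)).

End suspension.

Section random_measures.
Context {R : realType}.

Definition cvg_in_distribution
    {d1} {X : measurableType d1} (nu : probability X R) (Z : R -> X -> lfmeasure R)
    {d2} {Om : measurableType d2} (P : probability Om R) (xi : Om -> lfmeasure R)
    : Prop :=
  forall F : lfmeasure R -> R, continuous F ->
    (exists M : R, forall zeta, `|F zeta| <= M) ->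
  \int[nu]_x F (Z u x) @[u --> +oo] --> \int[P]_w F (xi w).

(* zeta0 takes values in the measures on the whole line, so shift_measure u
   keeps the mass that it moves to the left of 0. *)
Definition is_stationary_extension
    {d1} {X : measurableType d1} (nu : probability X R) (zeta0 : X -> lfmeasure R)
    {d2} {Om : measurableType d2} (P : probability Om R) (xi : Om -> lfmeasure R)
    : Prop :=
  cvg_in_distribution nu (fun u x => shift_measure u (zeta0 x)) P xi.

Local Open Scope ereal_scope.

(* For a stationary xi the ratio of the expected mass of (0, a] to a does not
   depend on a > 0; it is taken here at a = 1. *)
Definition intensity {d} {Om : measurableType d} (P : probability Om R)
    (xi : Om -> lfmeasure R) : \bar R :=
  \int[P]_w xi w `]0%R, 1%R]%classic.

(* The integral of g against the Palm distribution of xi, computed with the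
   Borel set B; it does not depend on B when xi is stationary. *)
Definition palm {d} {Om : measurableType d} (P : probability Om R)
    (xi : Om -> lfmeasure R) (B : set R) (g : lfmeasure R -> R) : \bar R :=
  (intensity P xi * lebesgue_measure B)^-1 *
    \int[P]_w \int[xi w]_(u in B) (g (shift_measure u (xi w)))%:E.

End random_measures.

(* Main.v *)
Require Import Defs.
From HB Require Import structures.
From mathcomp Require Import all_boot all_order all_algebra.
From mathcomp Require Import all_classical all_reals all_analysis measurable_realfun.
From mathcomp Require Import ring lra zify.

Set Implicit Arguments.
Unset Strict Implicit.
Unset Printing Implicit Defensive.

Import Order.TTheory GRing.Theory Num.Theory.
Import numFieldNormedType.Exports.

Local Open Scope classical_set_scope.
Local Open Scope ereal_scope.

(** Write P(x) for the hitting process of x, S_n for the Birkhoff sums of the roof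
function r, theta^u for the shift of measures, and rbar for the mean of r.

Let F be a continuous functional of locally finite measures, with values in
[0, 1], that only sees the positive half-line, and let chi >= 0 be a continuous
function with compact support.  The Campbell functional
   G(zeta) = int chi(u) F(theta^u zeta) zeta(du)
is vaguely continuous ([campbell_continuous]), because (u, zeta) |-> theta^u zeta
is jointly continuous and chi has compact support.  For x = (y, s), the points of
P(x) are the times t_n = S_(n+1)(y) - s with T^(n+1) y in D, and seen from t_n the
future of P(x) is P(T^(n+1) y, 0) ([shift_hitting_process]).  Hence
   G(theta^v P(x)) = sum_n k(T^(n+1) y) chi(S_(n+1)(y) - s - v),
where k(y) = 1_D(y) F(P(y, 0)).  Under nu, the integral over s in [0, r(y)[ turns
the n-th term into k(T^(n+1) y) (X(S_(n+1)(y)) - X(S_n(T y))) with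
X(t) = int_0^t chi(b - v) db.  As mu is T-invariant, the mu-integrals of these
terms telescope, and as soon as v is beyond the support of chi the sum is
   (1 / rbar) (int chi) (int k dmu)
([mean_campbell_hitting]).  Since r is bounded below, the points of P(x) are
uniformly separated and G(theta^v P(x)) is bounded uniformly in x and v
([campbell_bounded]); so the convergence in distribution of theta^v P(x) to xi
shows that E G(xi) has the same value ([mean_campbell_extension]).  Letting chi
vary, a monotone class argument gives, for every Borel set A,
   E int_A F(theta^u xi) xi(du) = (1 / rbar) (int k dmu) Leb(A)
([mean_shift_integral]).  With A = B, and with F = 1 and A = ]0, 1] for the
intensity, this is the theorem for such functionals F ([palm_extension]).

For a general f, the vague topology is generated by a countable family of tent
functions ([cvg_vague_tent]), so its Borel sets are generated by the finite
intersections of sets {zeta | int tent dzeta > c} ([lf_measurableE]).  The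
indicator of such an intersection, evaluated at the restriction of zeta to the
positive half-line, is the increasing limit of functionals F as above
([cvg_smooth_gt]).  Therefore the restrictions to the positive half-line of eta
and of P(y, 0), with y distributed according to mu( . | D), have the same law
([ge0_integral_int_pos_eq]), and f only depends on these restrictions. *)

(** * Continuous functions with compact support *)

Section test_functions.
Context {R : realType}.
Local Open Scope ring_scope.
Implicit Types (phi psi : test_function R) (zeta : lfmeasure R).

Lemma norm_le_segment (M : R) : [set x : R | `|x| <= M] = `[- M, M]%classic.
Proof. by apply/seteqP; split => x /=; rewrite in_itv/= ler_norml. Qed.

Lemma compact_norm_le (M : R) : compact [set x : R | `|x| <= M].
Proof. by rewrite norm_le_segment; exact: segment_compact. Qed.

Lemma test_of_compact (f : R -> R) (M : R) :
  (forall x, M < `|x| -> f x = 0) -> compact (closure [set x | f x != 0]).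
Proof.
move=> fM; apply: (@subclosed_compact _ _ [set x : R | `|x| <= M]).
- exact: closed_closure.
- exact: compact_norm_le.
have -> : [set x : R | `|x| <= M] = closure [set x : R | `|x| <= M].
  apply/closure_id; rewrite norm_le_segment; exact: itv_closed.
apply: closure_subset => x /=; rewrite leNgt; apply: contra => /fM ->.
by rewrite eqxx.
Qed.

Definition test_of (f : R -> R) (cf : continuous f) (M : R)
    (fM : forall x, M < `|x| -> f x = 0) : test_function R :=
  TestFunction cf (test_of_compact fM).

Lemma test_supp phi : exists2 M : R, 0 < M & forall x, M < `|x| -> phi x = 0.
Proof.
have [M [_ /(_ (`|M| + 1))]] := compact_bounded (@test_compact _ phi).
rewrite (le_lt_trans (ler_norm _)) ?ltrDl// => /(_ isT) h.
exists (`|M| + 1); first by rewrite ltr_wpDl.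
move=> x xM; apply/eqP; apply: contraTT xM => px0; rewrite -leNgt.
by apply: h; exact: subset_closure.
Qed.

Lemma test_bounded phi : exists2 C : R, 0 < C & forall x, `|phi x| <= C.
Proof.
have [M M0 hM] := test_supp phi.
have : compact (phi @` [set x : R | `|x| <= M]).
  apply: continuous_compact; last exact: compact_norm_le.
  apply: continuous_subspaceT; exact: test_continuous.
move=> /compact_bounded [C [_ /(_ (`|C| + 1))]].
rewrite (le_lt_trans (ler_norm _)) ?ltrDl// => /(_ isT) h.
exists (`|C| + 1); first by rewrite ltr_wpDl.
move=> x; have [xM|/hM ->] := leP `|x| M; last by rewrite normr0 addr_ge0.
by apply: h; exists x.
Qed.

Lemma measurable_test phi : measurable_fun [set: measurableTypeR R] phi.
Proof. by apply: continuous_measurable_fun; exact: test_continuous. Qed.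

Lemma measurable_norm_le (M : R) :
  measurable ([set x : R | `|x| <= M] : set (measurableTypeR R)).
Proof. by rewrite norm_le_segment; exact: measurable_itv. Qed.

Lemma integrable_test zeta phi : zeta.-integrable setT (EFin \o phi).
Proof.
have [M M0 hM] := test_supp phi.
have [C C0 hC] := test_bounded phi.
set K := [set x : R | `|x| <= M].
have mK : measurable (K : set (measurableTypeR R)) := measurable_norm_le M.
have -> : EFin \o phi = (EFin \o phi) \_ K.
  apply/funext => x; rewrite patchE; case: ifPn => // /negP xK.
  rewrite /= hM// ltNge; apply/negP => xM; apply: xK; exact/mem_set.
apply/(integrable_mkcond _ _).1 => //; apply: measurable_bounded_integrable => //.
- by apply: lfm_compact; exact: compact_norm_le.
- by apply: measurable_funTS; exact: measurable_test.
- exists C; split; first exact: num_real.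
  by move=> D CD x _ /=; apply: le_trans (hC x) (ltW CD).
Qed.

(** A test function is uniformly continuous: continuity is uniform on a compact
neighbourhood of the support, and two points outside the support give equal values. *)
Lemma test_unif phi (e : R) : 0 < e ->
  exists2 h : R, 0 < h & forall x y, `|x - y| < h -> `|phi x - phi y| <= e.
Proof.
move=> e0; have [M M0 hM] := test_supp phi.
have h0d : \forall h \near (0 : R)^'+, [set x : R | `|x| <= M + 1] `<=`
    (fun x => forall y, `|x - y| < h -> `|phi x - phi y| <= e).
  apply: ((compact_near_coveringP _).1 (@compact_norm_le (M + 1)) R (0 : R)^'+
    (fun h x => forall y, `|x - y| < h -> `|phi x - phi y| <= e) _) => x _.
  have e20 : 0 < e / 2 by rewrite divr_gt0.
  have : \forall y \near x, `|phi x - phi y| < e / 2.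
    exact: (cvgrPdist_lt _ _).1 (@test_continuous _ phi x) _ e20.
  move=> [d d0 xd] ; exists (ball x (d / 2), [set h | h < d / 2]).
    split => /=; first by apply: nbhsx_ballx; rewrite divr_gt0.
    by apply: nbhs_right_lt; rewrite divr_gt0.
  move=> [x' h] /= [xx' hd] y x'y.
  have x'd : `|phi x - phi x'| < e / 2.
    apply: xd => /=; apply: lt_trans xx' _; by rewrite ltr_pdivrMr// ltr_pMr// ltr1n.
  have yd : `|phi x - phi y| < e / 2.
    apply: xd => /=; rewrite -(subrKA x') (le_lt_trans (ler_normD _ _))//.
    rewrite [ltRHS](splitr d) ltrD//; exact: lt_trans x'y hd.
  rewrite -(subrKA (phi x)) (le_trans (ler_normD _ _))// (distrC (phi x')).
  by rewrite [leRHS](splitr e) lerD// ltW.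
have : \forall h \near (0 : R)^'+, [/\ 0 < h, h < 1 &
   forall x, `|x| <= M + 1 -> forall y, `|x - y| < h -> `|phi x - phi y| <= e].
  near=> h; split; [by []|by near: h; apply: nbhs_right_lt; rewrite ltr01|].
  near: h; exact: h0d.
move=> /filter_ex [h [h0' h1 hh]]; exists h => // x y xy.
have [xM|xM] := leP `|x| (M + 1); first exact: hh.
rewrite (hM x) ?(hM y) ?subrr ?normr0 ?ltW//; first last.
  by rewrite (lt_trans _ xM)// ltrDl.
rewrite -(ltrD2r 1) (lt_le_trans xM)//.
rewrite -[in leLHS](subrK y x) (le_trans (ler_normD _ _))// addrC lerD2l.
by rewrite (le_trans (ltW xy))// ltW.
Unshelve. all: by end_near.
Qed.

End test_functions.

(** * Integrals under vague convergence *)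

Section vague_convergence.
Context {R : realType}.
Local Open Scope ring_scope.
Local Notation lf := (lfmeasure R).
Implicit Types (phi psi : test_function R) (zeta : lf) (f g chi : R -> R).

(** Sums and shifts of test functions are handled as plain functions of this kind,
which avoids repackaging each of them with its continuity and its support. *)
Definition lf_integrable f := forall zeta, zeta.-integrable setT (EFin \o f).

Lemma test_lf_integrable phi : lf_integrable phi.
Proof. by move=> zeta; exact: integrable_test. Qed.

Lemma lf_integrableD f g : lf_integrable f -> lf_integrable g ->
  lf_integrable (fun x => f x + g x).
Proof. by move=> hf hg zeta; exact: integrableD (hf zeta) (hg zeta). Qed.

Lemma lf_integrableZ (k : R) f : lf_integrable f -> lf_integrable (fun x => k * f x).
Proof. by move=> hf zeta; exact: integrableZl (hf zeta). Qed.

Lemma lf_integrable_sum n (f : nat -> R -> R) : (forall j, lf_integrable (f j)) ->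
  lf_integrable (fun x => \sum_(j < n) f j x).
Proof.
move=> hf; elim: n => [|n ih].
  have -> : (fun x => \sum_(j < 0) f j x) = (fun x => 0 * f 0%N x).
    by apply/funext => x; rewrite big_ord0 mul0r.
  exact: lf_integrableZ.
rewrite (_ : (fun x => _) = fun x => \sum_(j < n) f j x + f n x).
  exact: lf_integrableD.
by apply/funext => x; rewrite big_ord_recr.
Qed.

Lemma Rintegral_lf_sum zeta n (f : nat -> R -> R) : (forall j, lf_integrable (f j)) ->
  \int[zeta]_x (\sum_(j < n) f j x) = \sum_(j < n) \int[zeta]_x f j x.
Proof.
move=> hf; elim: n => [|n ih].
  rewrite big_ord0; under eq_Rintegral do rewrite big_ord0.
  by rewrite /Rintegral integral0.
rewrite [RHS]big_ord_recr/= -ih -RintegralD//; last 2 first.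
- exact: lf_integrable_sum.
- exact: hf.
by apply: eq_Rintegral => x _; rewrite big_ord_recr.
Qed.

Lemma Rintegral_dist zeta f g chi (e : R) :
  lf_integrable f -> lf_integrable g -> lf_integrable chi ->
  (forall x, `|f x - g x| <= e * chi x) ->
  `|\int[zeta]_x f x - \int[zeta]_x g x| <= e * \int[zeta]_x chi x.
Proof.
move=> hf hg hchi fg.
have hfg : zeta.-integrable setT (EFin \o (fun x => f x - g x)).
  exact: integrableB (hf zeta) (hg zeta).
rewrite -(RintegralB measurableT (hf zeta) (hg zeta)).
apply: le_trans (le_normr_Rintegral _ hfg) _ => //.
rewrite -(RintegralZl _ measurableT (hchi zeta)).
apply: le_Rintegral => //; first exact: integrable_norm.
exact: lf_integrableZ hchi zeta.
Qed.

(** The masses int chi dZ are bounded along the filter, hence a function that is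
close to f relatively to chi has an integral close to that of f, uniformly along
the filter. *)
Lemma cvg_Rintegral_approx {X} (F : set_system X) {FF : Filter F} (Z : X -> lf)
    zeta f chi : lf_integrable f -> lf_integrable chi -> (forall x, 0 <= chi x) ->
  \int[Z w]_x chi x @[w --> F] --> \int[zeta]_x chi x ->
  (forall e, 0 < e -> exists g, [/\ lf_integrable g,
     forall x, `|f x - g x| <= e * chi x &
     \int[Z w]_x g x @[w --> F] --> \int[zeta]_x g x]) ->
  \int[Z w]_x f x @[w --> F] --> \int[zeta]_x f x.
Proof.
move=> hf hchi chi0 cchi happ; apply/cvgrPdist_le => e e0.
set C := \int[zeta]_x chi x + 1.
have C1 : 1 <= C by rewrite lerDr; exact: Rintegral_ge0.
have C0 : 0 < C by exact: lt_le_trans C1.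
have e3 : 0 < e / 3 by rewrite divr_gt0.
have [|g [hg fg cg]] := happ (e / 3 / C); first by rewrite divr_gt0.
have eC0 : 0 <= e / 3 / C by rewrite divr_ge0// ltW.
near=> w.
have h1 : \int[Z w]_x chi x <= C.
  have : `|\int[zeta]_x chi x - \int[Z w]_x chi x| <= 1.
    by near: w; exact: (cvgrPdist_le _ _).1 cchi _ ltr01.
  rewrite distrC ler_norml => /andP[_]; by rewrite lerBlDl.
have h2 : `|\int[zeta]_x g x - \int[Z w]_x g x| <= e / 3.
  by near: w; exact: (cvgrPdist_le _ _).1 cg _ e3.
have h3 (z : lf) : \int[z]_x chi x <= C ->
    `|\int[z]_x f x - \int[z]_x g x| <= e / 3.
  move=> zC; apply: le_trans (Rintegral_dist z hf hg hchi fg) _.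
  apply: le_trans (ler_wpM2l eC0 zC) _.
  by rewrite divfK// gt_eqF.
have h4 : `|\int[zeta]_x f x - \int[zeta]_x g x| <= e / 3.
  by apply: h3; rewrite lerDl.
have {h1}h5 : `|\int[Z w]_x f x - \int[Z w]_x g x| <= e / 3 by exact: h3.
by move: h2 h4 h5; rewrite !ler_norml; lra.
Unshelve. all: by end_near.
Qed.

Lemma cvg_initial (S : choiceType) (T : topologicalType) (h : S -> T)
    (F : set_system S) (s : S) : Filter F -> h @ F --> h s ->
  F --> (s : initial_topology h).
Proof.
move=> FF hF A; rewrite nbhsE => -[B [[C oC CB] Bs] BA]; apply: filterS BA _.
rewrite -CB; apply: hF; apply: open_nbhs_nbhs; split => //.
by rewrite -CB in Bs.
Qed.

Lemma cvg_vague {X} (F : set_system X) {FF : Filter F} (Z : X -> lf) zeta :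
  (forall phi, vague_pairing (Z w) phi @[w --> F] --> vague_pairing zeta phi) ->
  Z w @[w --> F] --> zeta.
Proof.
move=> Fz; apply: (@cvg_initial lf {ptws test_function R -> R} vague_pairing).
apply/cvg_sup => phi.
by apply: (@cvg_initial _ R (fun h : {ptws test_function R -> R} => h phi)); exact: Fz.
Qed.

Lemma vague_pairing_continuous phi :
  continuous (fun zeta : lf => vague_pairing zeta phi).
Proof.
move=> zeta.
have : vague_pairing @ nbhs zeta --> vague_pairing zeta.
  exact: (@initial_continuous lf {ptws test_function R -> R} vague_pairing).
move=> /cvg_sup/(_ phi) h.
apply: (@cvg_comp _ _ _ vague_pairing (fun h : {ptws test_function R -> R} => h phi) _ _ _ h).
exact: (@initial_continuous _ R (fun h : {ptws test_function R -> R} => h phi)).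
Qed.

(** The tent of index (m, N, j) is the piecewise linear bump of height 1 centred at
(j - N) / (m + 1), with half-width 1 / (m + 1); N translates the grid so that j can
be a natural number. *)
Definition tent (k : nat * nat * nat) (x : R) : R :=
  Num.max 0 (1 - `|k.1.1.+1%:R * x + k.1.2%:R - k.2%:R|).

Lemma tent_ge0 k x : 0 <= tent k x.
Proof. by rewrite /tent le_max lexx. Qed.

Lemma continuous_tent k : continuous (tent k).
Proof.
move=> x; apply: (@continuous_max R R (fun=> 0)
  (fun x => 1 - `|k.1.1.+1%:R * x + k.1.2%:R - k.2%:R|) x); first exact: cvg_cst.
apply: cvgB; first exact: cvg_cst.
apply: cvg_norm; apply: cvgB; last exact: cvg_cst.
apply: cvgD; last exact: cvg_cst.
by apply: cvgM; [exact: cvg_cst|exact: cvg_id].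
Qed.

Lemma tent_supp k x : k.2%:R + k.1.2%:R + 1 < `|x| -> tent k x = 0.
Proof.
case: k => -[m N] j /= xk; rewrite /tent/=; apply/max_idPl.
rewrite subr_le0.
have hN : 0 <= N%:R :> R by [].
have hj : 0 <= j%:R :> R by [].
have [x0|x0] := leP 0 x.
- rewrite (ger0_norm x0) in xk.
  have : x <= m.+1%:R * x by rewrite ler_peMl// ler1n.
  by move: (m.+1%:R * x) => a xa; rewrite ger0_norm; lra.
- rewrite (ltr0_norm x0) in xk.
  have : m.+1%:R * x <= x by rewrite ger_nMl// ler1n.
  by move: (m.+1%:R * x) => a xa; rewrite ler0_norm; lra.
Qed.

Definition tent_test k : test_function R :=
  test_of (@continuous_tent k) (tent_supp (k := k)).

(** Tents of a same grid add up to a piecewise linear plateau: each new tent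
completes the slope left by the previous one. *)
Lemma sum_tent m N n (x : R) : 0 <= m.+1%:R * x + N%:R ->
  \sum_(j < n) tent (m, N, j : nat) x =
  Num.min 1 (Num.max 0 (n%:R - (m.+1%:R * x + N%:R))).
Proof.
rewrite /tent/=; set y := _ + _ => y0.
elim: n => [|n ih].
  rewrite big_ord0 mulr0n sub0r; symmetry; rewrite /Num.min/Num.max.
  move: (y) y0 => z z0.
  case: (ltP 0 (- z)) => z1; case: ltP => z2; lra.
rewrite big_ord_recr/= ih -natr1; move: y y0 {ih} => y y0.
have : n%:R = 0 :> R \/ 1 <= n%:R :> R.
  by case: (n) => [|k]; [left|right; rewrite ler1n].
have n0 : 0 <= n%:R :> R by [].
move: (n%:R) n0 => a a0 na.
have [ya|ya] := leP y a; [rewrite ler0_norm ?subr_le0//|rewrite ger0_norm ?subr_ge0 1?ltW//];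
  rewrite /Num.min/Num.max;
  case: (ltP 0 (a - y)) => h1; case: (ltP 0 (a + 1 - y)) => h2;
  do ![case: ltP => ?]; case: na => na; lra.
Qed.
End vague_convergence.

(** * Tent functions generate the vague topology *)

Section vague_generation.
Context {R : realType}.
Local Open Scope ring_scope.
Local Notation lf := (lfmeasure R).
Implicit Types (phi psi : test_function R) (zeta : lf) (f g chi : R -> R).

Definition tent_interpolation phi (m N : nat) (x : R) : R :=
  \sum_(j < (N.*2).+1) phi ((j%:R - N%:R) / m.+1%:R) * tent (m, N, j : nat) x.

Lemma tent_lf_integrable k : lf_integrable (tent k : R -> R).
Proof. exact: (test_lf_integrable (tent_test k)). Qed.

(** In the window of half-width N / (m + 1), the tents form a partition of unity. *)
Lemma sum_tent1 (m N : nat) (x : R) : `|m.+1%:R * x| <= N%:R ->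
  \sum_(j < (N.*2).+1) tent (m, N, j : nat) x = 1.
Proof.
rewrite ler_norml => /andP[h1 h2]; rewrite sum_tent; last by rewrite -lerBlDr sub0r.
rewrite -natr1 -addnn natrD.
have -> : Num.max 0 (N%:R + N%:R + 1 - (m.+1%:R * x + N%:R)) =
          N%:R + 1 - m.+1%:R * x.
  by move: h1 h2; move: (N%:R) (m.+1%:R * x) => a b ? ?; rewrite (max_idPr _); lra.
by apply/min_idPl; move: h1 h2; move: (N%:R) (m.+1%:R * x) => a b ? ?; lra.
Qed.

Lemma sum_tent_le1 (m N n : nat) (x : R) : (n <= (N.*2).+1)%N ->
  \sum_(j < n) tent (m, N, j : nat) x <= 1.
Proof.
move=> nN; have [h|h] := leP 0 (m.+1%:R * x + N%:R).
  by rewrite sum_tent// ge_min lexx.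
case: n nN => [|n] nN; first by rewrite big_ord0.
rewrite big_ord_recl big1 ?addr0.
  by rewrite /tent ge_max ler01 gerBl normr_ge0.
move=> j _; rewrite /tent/=; apply/max_idPl.
have j0 : 1 <= (bump 0 j)%:R :> R by rewrite /bump leq0n ler1n.
move: h j0; move: (_%:R : R) (m.+1%:R * x + N%:R) => a b b0 a0.
by rewrite ler0_norm; lra.
Qed.

Lemma sum_tent_supp (m M : nat) (x : R) : (M.+1)%:R < `|x| ->
  forall j : 'I_(m.+1 * M).*2.+1, tent (m, (m.+1 * M)%N, j : nat) x = 0.
Proof.
move=> Mx j; rewrite /tent/=; apply/max_idPl.
have jN : (j : nat)%:R <= 2 * (m.+1 * M)%:R :> R.
  by rewrite -natrM ler_nat mul2n -ltnS.
have j0 : 0 <= (j : nat)%:R :> R by [].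
have hM : (m.+1 * M)%:R + 1 <= `|m.+1%:R * x|.
  rewrite normrM ger0_norm// natrM.
  have m1 : 1 <= m.+1%:R :> R by rewrite ler1n.
  apply: le_trans (ler_wpM2l _ (ltW Mx)) => //.
  by rewrite -[M.+1%:R]natr1 mulrDr mulr1 lerD2l.
move: hM jN j0; move: (m.+1%:R * x) ((m.+1 * M)%:R : R) ((j : nat)%:R : R) => a N i.
by case: (ler0P a) => a0 *; [rewrite ler0_norm|rewrite ger0_norm]; lra.
Qed.

(** A test function is close to its piecewise linear interpolation on a fine grid.
The error is at most e times the sum of the tents of the grid, which is itself
bounded by the sum chi of the tents of a fixed grid of mesh 1, whatever the mesh. *)
Lemma cvg_vague_tent {X} (F : set_system X) {FF : Filter F} (Z : X -> lf) zeta :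
  (forall k, \int[Z w]_x tent k x @[w --> F] --> \int[zeta]_x tent k x) ->
  Z w @[w --> F] --> zeta.
Proof.
move=> Zk; apply: cvg_vague => phi.
have [M0 M00 hM0] := test_supp phi.
pose M := (Num.truncn M0).+1.
have hM x : M%:R < `|x| -> phi x = 0.
  by move=> xM; apply: hM0; apply: lt_trans xM; exact: truncnS_gt.
have sumk m N n (c : nat -> R) :
    \int[Z w]_x (\sum_(j < n) c j * tent (m, N, j : nat) x) @[w --> F] -->
    \int[zeta]_x (\sum_(j < n) c j * tent (m, N, j : nat) x).
  have hI j : lf_integrable (fun x => c j * tent (m, N, j : nat) x).
    by apply: lf_integrableZ; exact: tent_lf_integrable.
  have E (z : lf) : \int[z]_x (\sum_(j < n) c j * tent (m, N, j : nat) x) =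
      \sum_(j < n) c j * \int[z]_x tent (m, N, j : nat) x.
    rewrite (Rintegral_lf_sum z n hI); apply: eq_bigr => j _.
    by rewrite RintegralZl//; exact: tent_lf_integrable.
  rewrite E; under eq_fun do rewrite E.
  elim: n {E} => [|n ih].
    by rewrite big_ord0; under [X in X @ _]eq_fun do rewrite big_ord0; exact: cvg_cst.
  rewrite big_ord_recr/=; under [X in X @ _]eq_fun do rewrite big_ord_recr/=.
  by apply: cvgD => //; apply: cvgM; [exact: cvg_cst|exact: Zk].
(* chi is 1 on [-(M + 1), M + 1], where all the interpolations are supported *)
pose chi (x : R) : R := \sum_(j < (M.+1.*2).+1) 1 * tent (0, M.+1, j : nat)%N x.
apply: (@cvg_Rintegral_approx _ _ _ _ Z zeta phi chi).
- exact: test_lf_integrable.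
- by apply: (@lf_integrable_sum _ _ (fun j x => 1 * tent (0, M.+1, j : nat)%N x)) => j;
    apply: lf_integrableZ; exact: tent_lf_integrable.
- by move=> x; apply: sumr_ge0 => j _; rewrite mul1r tent_ge0.
- exact: (sumk 0%N M.+1 _ (fun=> 1)).
move=> e e0; have [h h0 hphi] := test_unif phi e0.
pose m := Num.truncn h^-1.
exists (tent_interpolation phi m (m.+1 * M)%N); split.
- apply: (@lf_integrable_sum _ _ (fun j x =>
    phi ((j%:R - (m.+1 * M)%:R) / m.+1%:R) * tent (m, (m.+1 * M)%N, j : nat)%N x)) => j.
  by apply: lf_integrableZ; exact: tent_lf_integrable.
- move=> x; rewrite /tent_interpolation; set N := (m.+1 * M)%N.
  have mh : m.+1%:R^-1 < h.
    by rewrite invf_plt ?posrE//; exact: truncnS_gt.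
  have -> : phi x = \sum_(j < (N.*2).+1) phi x * tent (m, N, j : nat) x.
    rewrite -mulr_sumr; have [xM|/hM ->] := leP `|x| M%:R; last by rewrite mul0r.
    by rewrite sum_tent1 ?mulr1// normrM ger0_norm// natrM ler_pM2l.
  rewrite -sumrB; apply: (@le_trans _ _ (\sum_(j < (N.*2).+1) e * tent (m, N, j : nat) x)).
    apply: le_trans (ler_norm_sum _ _ _) _; apply: ler_sum => j _.
    rewrite -mulrBl normrM (ger0_norm (tent_ge0 _ _)).
    have [t0|] := eqVneq (tent (m, N, j : nat) x) 0; first by rewrite t0 !mulr0.
    move=> tN0; apply: ler_wpM2r; first exact: tent_ge0.
    apply: hphi; apply: le_lt_trans mh.
    rewrite -[leRHS]mul1r ler_pdivlMr//.
    have -> : `|x - (j%:R - N%:R) / m.+1%:R| * m.+1%:R = `|m.+1%:R * x + N%:R - j%:R|.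
      rewrite -[X in _ * X = _]ger0_norm// -normrM mulrBl divfK ?pnatr_eq0//.
      by congr `| _ |; ring.
    rewrite leNgt; apply: contra tN0 => t1; apply/eqP/max_idPl => /=.
    by rewrite subr_le0 ltW.
  rewrite -mulr_sumr ler_pM2l// /chi.
  have [xM|xM] := leP `|x| M.+1%:R; last first.
    rewrite big1; last by move=> j _; exact: sum_tent_supp.
    by apply: sumr_ge0 => j _; rewrite mul1r tent_ge0.
  under [leRHS]eq_bigr do rewrite mul1r.
  by rewrite [leRHS]sum_tent1 ?mul1r// sum_tent_le1.
- exact: (sumk _ _ _ (fun j => phi ((j%:R - (m.+1 * M)%:R) / m.+1%:R))).
Qed.

(** Rational bounds make the family of these neighbourhoods countable. *)
Definition tent_box (s : seq ((nat * nat * nat) * (rat * rat))) : set lf :=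
  [set zeta : lf | forall p, p \in s ->
    ratr p.2.1 < \int[zeta]_x tent p.1 x < ratr p.2.2].

(** The boxes around zeta generate a filter along which all tent integrals converge,
so this filter converges to zeta. *)
Lemma open_tent_box (U : set lf) zeta : open U -> U zeta ->
  exists2 s, tent_box s zeta & tent_box s `<=` U.
Proof.
move=> oU Uz.
pose F := filter_from [set s | tent_box s zeta] tent_box.
have FF : Filter F.
  apply: filter_from_filter; first by exists [::] => p.
  move=> s1 s2 h1 h2; exists (s1 ++ s2).
    by move=> p; rewrite mem_cat => /orP[/h1|/h2].
  by move=> z hz; split=> p ps; apply: hz; rewrite mem_cat ps ?orbT.
have Fz : id w @[w --> F] --> zeta.
  apply: cvg_vague_tent => k; apply/cvgrPdist_lt => e e0.
  set c := \int[zeta]_x tent k x.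
  have ce1 : c - e < c by rewrite ltrBlDr ltrDl.
  have ce2 : c < c + e by rewrite ltrDl.
  have [a] := rat_in_itvoo ce1; rewrite in_itv/= => /andP[a1 a2].
  have [b] := rat_in_itvoo ce2; rewrite in_itv/= => /andP[b1 b2].
  exists [:: (k, (a, b))] => [p|z /(_ (k, (a, b)))].
    by rewrite inE => /eqP ->/=; rewrite a2 b1.
  rewrite inE eqxx => /(_ isT)/=/andP[z1 z2].
  by rewrite /= ltr_norml; apply/andP; split; lra.
have : F U by apply: Fz; exact: open_nbhs_nbhs.
by move=> [s sz sU]; exists s.
Qed.

Definition tent_gt (s : seq ((nat * nat * nat) * R)) : set lf :=
  [set zeta : lf | forall p, p \in s -> p.2 < \int[zeta]_x tent p.1 x].

Lemma tent_gtI : setI_closed (range tent_gt).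
Proof.
move=> _ _ [s _ <-] [t _ <-]; exists (s ++ t) => //; apply/seteqP; split.
  by move=> z hz; split=> p ps; apply: hz; rewrite mem_cat ps ?orbT.
by move=> z [h1 h2] p; rewrite mem_cat => /orP[/h1|/h2].
Qed.

(** An open set is the union of the boxes that it contains, of which there are
countably many. *)
Lemma open_sigma_tent (U : set lf) : open U -> <<s range tent_gt >> U.
Proof.
move=> oU.
pose I := [set s | tent_box s `<=` U].
pose box n := if unpickle n is Some s then
  (if `[< I s >] then tent_box s else set0) else set0.
have -> : U = \bigcup_n box n.
  apply/seteqP; split => z.
    move=> Uz; have [s sz sU] := open_tent_box oU Uz.
    by exists (pickle s) => //; rewrite /box pickleK; case: asboolP.
  by move=> [n _]; rewrite /box; case: unpickle => // s; case: asboolP => // + zs; exact.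
pose S := g_sigma_algebraType (range tent_gt).
suff mbox s : measurable (tent_box s : set S).
  apply: (@bigcupT_measurable _ S) => n; rewrite /box.
  by case: unpickle => // t; case: asboolP.
have gtm k (a : R) : measurable ([set z : lf | a < \int[z]_x tent k x] : set S).
  apply: sub_sigma_algebra; exists [:: (k, a)] => //; apply/seteqP; split.
    by move=> z /(_ (k, a)); rewrite inE eqxx => /(_ isT).
  by move=> z /= hz p; rewrite inE => /eqP ->.
have mk k : measurable_fun [set: S] (fun z : lf => \int[z]_x tent k x).
  apply: (measurability _ (RGenOInfty.measurableE R)) => _ [_ [a ->] <-].
  rewrite setTI (_ : _ @^-1` _ = [set z : lf | a < \int[z]_x tent k x])//.
  by apply/seteqP; split => z; rewrite /preimage/= in_itv/= andbT.
elim: s => [|[k [a b]] s ih].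
  by rewrite (_ : tent_box _ = setT)//; apply/seteqP; split => // z _ p.
rewrite (_ : tent_box _ =
   ((fun z : lf => \int[z]_x tent k x) @^-1` `]ratr a, ratr b[) `&` tent_box s).
  apply: measurableI => //; rewrite -[X in measurable X]setTI.
  by apply: mk => //; exact: measurable_itv.
apply/seteqP; split => z.
  move=> h; split; first by rewrite /= in_itv/=; apply: (h (k, (a, b))); rewrite inE eqxx.
  by move=> p ps; apply: h; rewrite inE ps orbT.
by move=> [/=]; rewrite in_itv/= => h1 h2 p; rewrite inE => /predU1P[-> //|/h2].
Qed.

Lemma continuous_lf_measurable (F : lf -> R) : continuous F ->
  measurable_fun [set: lf] F.
Proof.
move=> /continuousP cF; apply: (measurability _ (RGenOpens.measurableE R)).
move=> _ [_ [a [b ->]] <-]; rewrite setTI; apply: sub_sigma_algebra.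
exact/cF/interval_open.
Qed.

Lemma continuous_tent_Rintegral k : continuous (fun z : lf => \int[z]_x tent k x).
Proof. exact: (@vague_pairing_continuous R (tent_test k)). Qed.

Lemma lf_measurableE : @measurable _ lf = <<s range tent_gt >>.
Proof.
apply/seteqP; split.
  apply: smallest_sub; first exact: smallest_sigma_algebra.
  by move=> U oU; exact: open_sigma_tent.
apply: smallest_sub; first exact: sigma_algebra_measurable.
move=> _ [s _ <-].
elim: s => [|[k a] s ih].
  rewrite (_ : tent_gt _ = setT); first exact: measurableT.
  by apply/seteqP; split => // z _ p.
rewrite (_ : tent_gt _ =
   ((fun z : lf => \int[z]_x tent k x) @^-1` `]a, +oo[) `&` tent_gt s).
  apply: measurableI => //; rewrite -[X in measurable X]setTI.
  have mk := continuous_lf_measurable (@continuous_tent_Rintegral k).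
  by apply: (mk measurableT); exact: measurable_itv.
apply/seteqP; split => z.
  move=> h; split; first by rewrite /= in_itv/= andbT; apply: (h (k, a)); rewrite inE eqxx.
  by move=> p ps; apply: h; rewrite inE ps orbT.
by move=> [/=]; rewrite in_itv/= andbT => h1 h2 p; rewrite inE => /predU1P[-> //|/h2].
Qed.

Lemma measurable_fun_lf d (X : measurableType d) (D : set X) (h : X -> lf) :
  (forall k, measurable_fun D (fun x => \int[h x]_t tent k t)) ->
  measurable_fun D h.
Proof.
move=> hk mD; apply: (measurability _ lf_measurableE) => //.
move=> _ [_ [s _ <-] <-].
elim: s => [|[k a] s ih].
  rewrite (_ : tent_gt _ = setT) ?preimage_setT ?setIT//.
  by apply/seteqP; split => // z _ p.
rewrite (_ : tent_gt _ =
   ((fun z : lf => \int[z]_x tent k x) @^-1` `]a, +oo[) `&` tent_gt s).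
  rewrite preimage_setI setIIr.
  by apply: measurableI => //; apply: hk => //; exact: measurable_itv.
apply/seteqP; split => z.
  move=> hz; split; first by rewrite /= in_itv/= andbT; apply: (hz (k, a)); rewrite inE eqxx.
  by move=> p ps; apply: hz; rewrite inE ps orbT.
by move=> [/=]; rewrite in_itv/= andbT => h1 h2 p; rewrite inE => /predU1P[-> //|/h2].
Qed.
End vague_generation.

(** * Continuity of the shift and of Campbell functionals *)

Section shift_continuity.
Context {R : realType}.
Local Open Scope ring_scope.
Local Notation lf := (lfmeasure R).
Implicit Types (phi psi : test_function R) (zeta : lf) (f g chi : R -> R).

(** Convergence of integrals when both the measure and the integrand vary, the
integrand converging uniformly relatively to the weight chi. *)
Lemma cvg_Rintegral_var {X} (F : set_system X) {FF : Filter F} (Z : X -> lf)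
    zeta (fw : X -> R -> R) f chi :
  (forall w, lf_integrable (fw w)) -> lf_integrable f -> lf_integrable chi ->
  (forall x, 0 <= chi x) ->
  \int[Z w]_x chi x @[w --> F] --> \int[zeta]_x chi x ->
  (forall e, 0 < e -> \forall w \near F, forall x, `|fw w x - f x| <= e * chi x) ->
  \int[Z w]_x f x @[w --> F] --> \int[zeta]_x f x ->
  \int[Z w]_x fw w x @[w --> F] --> \int[zeta]_x f x.
Proof.
move=> hfw hf hchi chi0 cchi happ cf; apply/cvgrPdist_le => e e0.
set C := \int[zeta]_x chi x + 1.
have C0 : 0 < C by rewrite ltr_wpDl//; exact: Rintegral_ge0.
have e2 : 0 < e / 2 by rewrite divr_gt0.
have eC : 0 < e / 2 / C by rewrite divr_gt0.
near=> w.
have h1 : \int[Z w]_x chi x <= C.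
  have : `|\int[zeta]_x chi x - \int[Z w]_x chi x| <= 1.
    by near: w; exact: (cvgrPdist_le _ _).1 cchi _ ltr01.
  by rewrite distrC ler_norml => /andP[_]; rewrite lerBlDl.
have h2 : `|\int[zeta]_x f x - \int[Z w]_x f x| <= e / 2.
  by near: w; exact: (cvgrPdist_le _ _).1 cf _ e2.
have h3 : `|\int[Z w]_x fw w x - \int[Z w]_x f x| <= e / 2.
  apply: le_trans (Rintegral_dist (Z w) (hfw w) hf hchi _) _.
    by near: w; exact: happ _ eC.
  by apply: le_trans (ler_wpM2l (ltW eC) h1) _; rewrite divfK// gt_eqF.
by move: h2 h3; rewrite !ler_norml; lra.
Unshelve. all: by end_near.
Qed.

Definition cut (M x : R) : R := Num.min 1 (Num.max 0 (M + 1 - `|x|)).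

Lemma continuous_cut M : continuous (cut M).
Proof.
move=> x; apply: (@continuous_min R R (fun=> 1)
  (fun x => Num.max 0 (M + 1 - `|x|)) x); first exact: cvg_cst.
apply: (@continuous_max R R (fun=> 0)); first exact: cvg_cst.
apply: cvgB; first exact: cvg_cst.
by apply: cvg_norm; exact: cvg_id.
Qed.

Lemma cut_supp M x : `|M| + 1 < `|x| -> cut M x = 0.
Proof.
move=> Mx; rewrite /cut (max_idPl _); first by apply/min_idPr.
by rewrite subr_le0 (le_trans _ (ltW Mx))// lerD2r ler_norm.
Qed.

Lemma cut_ge0 M x : 0 <= cut M x.
Proof. by rewrite /cut le_min ler01 le_max lexx. Qed.

Lemma cut1 M x : `|x| <= M -> cut M x = 1.
Proof.
move=> xM; rewrite /cut; apply/min_idPl; rewrite le_max; apply/orP; right; lra.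
Qed.

Lemma le_cut M N x : M <= N -> cut M x <= cut N x.
Proof.
by move=> MN; rewrite /cut le_min2// le_max2// lerB// lerD2r.
Qed.

Definition cut_test M : test_function R :=
  test_of (@continuous_cut M) (@cut_supp M).

Lemma test_shift_supp phi u : exists M : R,
  forall x, M < `|x| -> phi (x - u) = 0.
Proof.
have [M M0 hM] := test_supp phi; exists (M + `|u|) => x xM; apply: hM.
rewrite -(ltrD2r `|u|) (lt_le_trans xM)//.
by rewrite -[in leLHS](subrK u x) ler_normD.
Qed.

Lemma test_shift_continuous phi u : continuous (fun x => phi (x - u)).
Proof.
move=> x; apply: (@continuous_comp _ _ _ (fun x => x - u) phi).
  by apply: cvgB; [exact: cvg_id|exact: cvg_cst].
exact: test_continuous.
Qed.

Definition test_shift phi u : test_function R :=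
  test_of (@test_shift_continuous phi u) (projT2 (cid (test_shift_supp phi u))).

Lemma shift_measureE u zeta (A : set R) :
  shift_measure u zeta A = zeta ((fun x => x - u) @^-1` A).
Proof.
rewrite /= /shift_fun; congr (zeta _).
apply/seteqP; split=> [_ [b Bb <-]|x Bx] /=; first by rewrite addrK.
by exists (x - u) => //; rewrite subrK.
Qed.

Lemma measurable_subr (u : R) :
  measurable_fun [set: measurableTypeR R] (fun x : R => (x - u : measurableTypeR R)).
Proof. by apply: measurable_funB => //. Qed.

Lemma ge0_integral_shift u zeta (A : set R) (h : R -> \bar R) :
  measurable A -> measurable_fun A h -> (forall x, 0 <= h x)%E ->
  (\int[shift_measure u zeta]_(x in A) h x =
   \int[zeta]_(x in (fun x : R => x - u)%R @^-1` A) h (x - u)%R)%E.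
Proof.
move=> mA mh h0.
rewrite -(ge0_integral_pushforward (measurable_subr u) zeta mA mh)//.
apply: eq_measure_integral; first exact: measurable_subr.
by move=> ? B mB _; rewrite shift_measureE.
Qed.

Lemma Rintegral_shift u zeta phi :
  \int[shift_measure u zeta]_x phi x = \int[zeta]_x phi (x - u).
Proof.
rewrite /Rintegral; congr fine.
have mphi : measurable_fun [set: measurableTypeR R] (EFin \o phi).
  by apply/measurable_EFinP; exact: measurable_test.
have := integral_pushforward (measurable_subr u) (mu := zeta) mphi _ measurableT.
rewrite preimage_setT => <-; last exact: (integrable_test zeta (test_shift phi u)).
apply: eq_measure_integral; first exact: measurable_subr.
by move=> ? B mB _; rewrite shift_measureE.
Qed.

(** After a change of variable the shift acts on the test function, whose small
translations are uniformly close to it. *)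
Lemma shift_continuous : continuous (fun p : R * lf => shift_measure p.1 p.2).
Proof.
move=> [u zeta]; apply: cvg_vague => phi; rewrite /vague_pairing Rintegral_shift.
under eq_fun do rewrite Rintegral_shift.
have [M M0 hM] := test_supp phi.
have cpair psi : \int[(p : R * lf).2]_x psi x @[p --> nbhs (u, zeta)] --> \int[zeta]_x psi x.
  apply: (@cvg_comp _ _ _ snd (fun z : lf => \int[z]_x psi x) _ (nbhs zeta)).
    exact: cvg_snd.
  exact: vague_pairing_continuous.
apply: (@cvg_Rintegral_var _ _ _ (fun p : R * lf => p.2) zeta
  (fun p x => phi (x - p.1)) (fun x => phi (x - u)) (cut (M + `|u| + 1))).
- by move=> p; exact: test_lf_integrable (test_shift phi p.1).
- exact: test_lf_integrable (test_shift phi u).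
- exact: test_lf_integrable (cut_test _).
- by move=> x; exact: cut_ge0.
- exact: (cpair (cut_test (M + `|u| + 1))).
- move=> e e0; have [h h0 hphi] := test_unif phi e0.
  have hm : 0 < Num.min h 1 by rewrite lt_min h0 ltr01.
  have hu : \forall v \near u, `|u - v| < Num.min h 1.
    exact: (nbhsx_ballx u _ hm).
  have hp : \forall p \near (u, zeta), `|u - p.1| < Num.min h 1.
    exact: (@cvg_fst _ _ (nbhs u) (nbhs zeta) _ _ hu).
  apply: filterS hp => -[v z] /=; rewrite lt_min => /andP[uh u1] x.
  have [xM|xM] := leP `|x| (M + `|u| + 1).
    rewrite cut1// mulr1; apply: hphi.
    by rewrite (_ : x - v - (x - u) = u - v)//; ring.
  have xu : M < `|x - u|.
    by have := ler_normD (x - u) u; rewrite subrK; lra.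
  have xv : M < `|x - v|.
    have := ler_normD (x - v) v; have := ler_normB u (u - v).
    by rewrite subrK (_ : u - (u - v) = v); [lra|ring].
  by rewrite !hM// subrr normr0 mulr_ge0 ?cut_ge0// ltW.
- exact: (cpair (test_shift phi u)).
Qed.

Section campbell_functional.
Variables (chi : test_function R) (F : lf -> R).
Hypothesis chi_ge0 : forall x, 0 <= chi x.
Hypothesis F_continuous : continuous F.

Lemma shift_comp_continuous zeta : continuous (fun u => F (shift_measure u zeta)).
Proof.
move=> u; apply: (@continuous_comp _ _ _ (fun u => shift_measure u zeta) F); last first.
  exact: F_continuous.
apply: (@cvg_comp _ _ _ (fun u : R => (u, zeta))
  (fun p : R * lf => shift_measure p.1 p.2) _ (nbhs (u, zeta))).
  exact: (@cvg_pair R R lf (nbhs u) (nbhs u) (nbhs zeta) _ _ _ id (fun=> zeta) cvg_id (cvg_cst _)).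
exact: (@shift_continuous (u, zeta)).
Qed.

Lemma campbell_test_continuous zeta :
  continuous (fun u => chi u * F (shift_measure u zeta)).
Proof.
by move=> u; apply: cvgM; [exact: test_continuous|exact: shift_comp_continuous].
Qed.

Lemma campbell_test_supp zeta : exists M : R,
  forall u, M < `|u| -> chi u * F (shift_measure u zeta) = 0.
Proof.
by have [M _ hM] := test_supp chi; exists M => u /hM ->; rewrite mul0r.
Qed.

Definition campbell_test zeta : test_function R :=
  test_of (@campbell_test_continuous zeta) (projT2 (cid (campbell_test_supp zeta))).

(** For F = 1 this is the integral of chi; in general each point u of the measure is
weighted by what F sees from u. *)
Definition campbell zeta : R := \int[zeta]_u (chi u * F (shift_measure u zeta)).

(** When zeta' is close to zeta, F(theta^u zeta') is close to F(theta^u zeta)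
uniformly in u on the compact support of chi, by joint continuity of the shift; and
u |-> chi(u) F(theta^u zeta) is a test function. *)
Lemma campbell_continuous : continuous campbell.
Proof.
move=> zeta; rewrite /campbell.
have [M M0 hM] := test_supp chi.
apply: (@cvg_Rintegral_var _ (nbhs zeta) _ id zeta
  (fun z u => chi u * F (shift_measure u z))
  (fun u => chi u * F (shift_measure u zeta)) chi).
- by move=> z; exact: test_lf_integrable (campbell_test z).
- exact: test_lf_integrable (campbell_test zeta).
- exact: test_lf_integrable.
- by [].
- exact: vague_pairing_continuous.
- move=> e e0.
  have hK : \forall z \near zeta, [set u : R | `|u| <= M] `<=`
     (fun u => `|F (shift_measure u z) - F (shift_measure u zeta)| <= e).
    apply: ((compact_near_coveringP _).1 (@compact_norm_le R M) lf (nbhs zeta)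
      (fun z u => `|F (shift_measure u z) - F (shift_measure u zeta)| <= e) _) => u _.
    have e2 : 0 < e / 2 by rewrite divr_gt0.
    have : \forall p \near (u, zeta),
        `|F (shift_measure u zeta) - F (shift_measure p.1 p.2)| <= e / 2.
      suff h : {for (u, zeta), continuous (F \o (fun p : R * lf => shift_measure p.1 p.2))}.
        exact: (cvgrPdist_le _ _).1 h _ e2.
      apply: (@continuous_comp _ _ _ (fun p : R * lf => shift_measure p.1 p.2) F
        (u, zeta)); [exact: (@shift_continuous (u, zeta))|exact: F_continuous].
    have : \forall p \near (u, zeta),
        `|F (shift_measure u zeta) - F (shift_measure p.1 zeta)| <= e / 2.
      have h : \forall v \near u,
          `|F (shift_measure u zeta) - F (shift_measure v zeta)| <= e / 2.
        exact: (cvgrPdist_le _ _).1 (@shift_comp_continuous zeta u) _ e2.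
      exact: (@cvg_fst _ _ (nbhs u) (nbhs zeta) _ _ h).
    apply: filterS2 => -[v z] /= h1 h2.
    by move: h1 h2; rewrite !ler_norml; lra.
  apply: filterS hK => z hz u; rewrite -mulrBr normrM ger0_norm//.
  rewrite mulrC; have [/hz zu|/hM ->] := leP `|u| M; last by rewrite !mulr0.
  by rewrite ler_wpM2r.
- exact: (@vague_pairing_continuous _ (campbell_test zeta)).
Qed.

End campbell_functional.
End shift_continuity.

(** * Monotone class arguments on the real line *)

Section real_rays.
Context {R : realType}.
Local Open Scope ring_scope.
Local Open Scope ereal_scope.

(** Open rays form a pi-system that generates the Borel sets. *)
Lemma borel_induction (P : set (set (measurableTypeR R))) :
  P setT -> (forall a : R, P `]a, +oo[%classic) ->
  (forall S, measurable S -> P S -> P (~` S)) ->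
  (forall F : (set (measurableTypeR R))^nat, (forall n, measurable (F n)) ->
    trivIset setT F -> (forall n, P (F n)) -> P (\bigcup_k F k)) ->
  forall S, measurable S -> P S.
Proof.
move=> PT Pray PC PU S mS.
have RE : @measurable _ (measurableTypeR R) = <<s @RGenOInfty.G R >>.
  exact: RGenOInfty.measurableE.
apply: (@dynkin_induction _ (measurableTypeR R) (@RGenOInfty.G R)) => //.
- move=> _ _ [a ->] [b ->]; exists (Num.max a b); apply/seteqP; split => x /=.
    by move=> []; rewrite !in_itv/= !andbT gt_max => -> ->.
  by rewrite !in_itv/= !andbT gt_max => /andP[].
- by move=> _ [a ->].
- by rewrite -RE.
Qed.

Lemma cvg_integral_mono d (T : measurableType d) (mu : {measure set T -> \bar R})
    (D : set T) (g : nat -> T -> \bar R) (f : T -> \bar R) : measurable D ->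
  (forall n, measurable_fun D (g n)) -> (forall n x, 0 <= g n x) ->
  (forall x, nondecreasing_seq (g ^~ x)) -> (forall x, D x -> g ^~ x @ \oo --> f x) ->
  \int[mu]_(x in D) g n x @[n --> \oo] --> \int[mu]_(x in D) f x.
Proof.
move=> mD mg g0 ndg gf.
rewrite (_ : \int[mu]_(x in D) f x = \int[mu]_(x in D) limn (g ^~ x)); last first.
  by apply: eq_integral => x /set_mem Dx; apply/esym/cvg_lim => //; exact: gf.
by apply: cvg_monotone_convergence => // x _; exact: ndg.
Qed.

Local Open Scope ring_scope.

(** A continuous function that increases with n to the indicator of the positive
half-line. *)
Definition ramp (n : nat) (x : R) : R := Num.min 1 (Num.max 0 (n%:R * x)).

Lemma continuous_ramp n : continuous (ramp n).
Proof.
move=> x; apply: (@continuous_min R R (fun=> 1)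
  (fun x => Num.max 0 (n%:R * x)) x); first exact: cvg_cst.
apply: (@continuous_max R R (fun=> 0)); first exact: cvg_cst.
by apply: cvgM; [exact: cvg_cst|exact: cvg_id].
Qed.

Lemma ramp_ge0 n x : 0 <= ramp n x.
Proof. by rewrite /ramp le_min ler01 le_max lexx. Qed.

Lemma ramp_le1 n x : ramp n x <= 1.
Proof. by rewrite /ramp ge_min lexx. Qed.

Lemma ramp0 n x : x <= 0 -> ramp n x = 0.
Proof.
move=> x0; rewrite /ramp (max_idPl _) ?mulr_ge0_le0//; exact/min_idPr.
Qed.

Lemma le_ramp n m x y : (n <= m)%N -> x <= y -> ramp n x <= ramp m y.
Proof.
move=> nm xy; have [x0|x0] := leP x 0; first by rewrite ramp0// ramp_ge0.
by rewrite /ramp le_min2// le_max2// ler_pM// ?ler_nat// ltW.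
Qed.

Lemma ramp_eq1 n x : n%:R^-1 <= x -> (0 < n)%N -> ramp n x = 1.
Proof.
move=> nx n0; apply/min_idPl; rewrite le_max; apply/orP; right.
by rewrite -ler_pdivrMl ?ltr0n// mulr1.
Qed.

Lemma ramp_near1 x : 0 < x -> \forall n \near \oo, ramp n x = 1.
Proof.
move=> x0; exists (Num.truncn x^-1).+1 => // n /= xn.
have n0 : (0 < n)%N by exact: leq_trans xn.
apply: ramp_eq1 => //; rewrite invf_ple ?posrE ?ltr0n//.
by apply: le_trans (ltW (truncnS_gt _)) _; rewrite ler_nat.
Qed.

Lemma cvg_ramp x : ramp n x @[n --> \oo] --> (((0 < x)%R : nat)%:R : R).
Proof.
have [x0|x0] := ltP 0 x.
  by apply: cvg_near_cst; apply: filterS (ramp_near1 x0) => n ->.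
by apply: cvg_near_cst; apply: nearW => n; rewrite ramp0.
Qed.

Lemma cvg_integral_ray (m : {measure set (measurableTypeR R) -> \bar R}) (a : R)
    (k : R -> R) : measurable_fun [set: measurableTypeR R] k -> (forall u, 0 <= k u) ->
  (\int[m]_u (ramp n (u - a) * k u)%:E)%E @[n --> \oo] -->
  (\int[m]_(u in `]a, +oo[) (k u)%:E)%E.
Proof.
move=> mk k0; rewrite integral_mkcond.
apply: cvg_integral_mono => //.
- move=> n; apply/measurable_EFinP; apply: measurable_funM => //.
  apply: (measurableT_comp (continuous_measurable_fun (@continuous_ramp n))).
  exact: measurable_subr.
- by move=> n x; rewrite lee_fin mulr_ge0// ramp_ge0.
- by move=> x i j ij; rewrite lee_fin ler_wpM2r// le_ramp.
- move=> x _; rewrite patchE.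
  rewrite (_ : (if _ then _ else _) = (((0 < x - a)%R : nat)%:R * k x)%:E); last first.
    rewrite subr_gt0; have [ax|ax] := ltP a x.
      by rewrite mem_set ?mul1r//= in_itv/= ax.
    by rewrite memNset ?mul0r//= in_itv/= ltNge ax.
  by apply: cvg_EFin; [exact: nearW|apply: cvgM; [exact: cvg_ramp|exact: cvg_cst]].
Qed.

Lemma test_mul_supp (phi : test_function R) (g : R -> R) : exists M : R,
  forall u, M < `|u| -> phi u * g u = 0.
Proof. by have [M _ hM] := test_supp phi; exists M => u /hM ->; rewrite mul0r. Qed.

Lemma test_mul_continuous (phi : test_function R) (g : R -> R) : continuous g ->
  continuous (fun x => phi x * g x).
Proof. by move=> cg x; apply: cvgM; [exact: test_continuous|exact: cg]. Qed.

Definition test_mul (phi : test_function R) (g : R -> R) (cg : continuous g) :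
    test_function R :=
  test_of (@test_mul_continuous phi g cg) (projT2 (cid (test_mul_supp phi g))).

Lemma continuous_ramp_sub n a : continuous (fun u => ramp n (u - a)).
Proof.
move=> x; apply: (@continuous_comp _ _ _ (fun x => x - a) (ramp n)).
  by apply: cvgB; [exact: cvg_id|exact: cvg_cst].
exact: continuous_ramp.
Qed.

End real_rays.

(** * Mean measures on Borel sets *)

Section lebesgue_lf.
Context {R : realType}.
Local Open Scope ring_scope.
Local Open Scope ereal_scope.

Definition lebesgue_lf : lfmeasure R := @LFMeasure R lebesgue_measure (@compact_finite_measure R).

End lebesgue_lf.

Section campbell_measure.
Context {R : realType}.
Local Open Scope ring_scope.
Local Open Scope ereal_scope.
Local Notation lf := (lfmeasure R).
Variable F : lf -> R.
Hypothesis F_continuous : continuous F.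
Hypothesis F_ge0 : forall z, (0 <= F z)%R.
Local Notation test := (test_function R).
Implicit Type chi : test.

Let mF (z : lf) : measurable_fun [set: measurableTypeR R]
  (fun u => F (shift_measure u z)).
Proof. by apply: continuous_measurable_fun => u; exact: shift_comp_continuous. Qed.

Let mchi chi (z : lf) : measurable_fun [set: measurableTypeR R]
  (fun u => chi u * F (shift_measure u z))%R.
Proof. by apply: measurable_funM => //; exact: measurable_test. Qed.

Let mEk chi (z : lf) : measurable_fun [set: measurableTypeR R]
  (fun u => (chi u * F (shift_measure u z))%:E).
Proof. by apply/measurable_EFinP; exact: mchi. Qed.

(** For fixed chi and z this is a finite measure in A, which allows a monotone class
argument; its total mass is the Campbell functional. *)
Definition campbell_on chi (A : set R) (z : lf) : \bar R :=
  \int[z]_(u in A) (chi u * F (shift_measure u z))%:E.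

Lemma campbell_onT chi z : campbell_on chi setT z = (campbell chi F z)%:E.
Proof.
rewrite /campbell /Rintegral fineK//; apply: integrable_fin_num => //.
exact: integrable_test z (campbell_test chi F_continuous z).
Qed.

Lemma measurable_campbell_onT chi : (forall u, 0 <= chi u)%R ->
  measurable_fun [set: lf] (campbell_on chi setT).
Proof.
move=> chi0; rewrite (_ : campbell_on chi setT = EFin \o campbell chi F); last first.
  by apply/funext => z; exact: campbell_onT.
apply/measurable_EFinP; apply: continuous_lf_measurable => z.
exact: campbell_continuous.
Qed.

Let chiF0 chi z u : (forall u, 0 <= chi u)%R -> (0 <= chi u * F (shift_measure u z))%R.
Proof. by move=> chi0; rewrite mulr_ge0. Qed.

Lemma campbell_on_ge0 chi A z : (forall u, 0 <= chi u)%R -> 0 <= campbell_on chi A z.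
Proof. by move=> chi0; apply: integral_ge0 => u _; rewrite lee_fin chiF0. Qed.

Lemma campbell_on_le chi A z : (forall u, 0 <= chi u)%R -> measurable A ->
  campbell_on chi A z <= campbell_on chi setT z.
Proof.
move=> chi0 mA; apply: ge0_subset_integral => //.
by move=> u _; rewrite lee_fin chiF0.
Qed.

Lemma campbell_on_fin chi A z : (forall u, 0 <= chi u)%R -> measurable A ->
  campbell_on chi A z \is a fin_num.
Proof.
move=> chi0 mA; rewrite ge0_fin_numE ?campbell_on_ge0//.
by apply: le_lt_trans (campbell_on_le z chi0 mA) _; rewrite campbell_onT ltry.
Qed.

Lemma campbell_onC chi A z : (forall u, 0 <= chi u)%R -> measurable A ->
  campbell_on chi setT z = campbell_on chi A z + campbell_on chi (~` A) z.
Proof.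
move=> chi0 mA; rewrite /campbell_on -ge0_integral_setU ?setUv//.
- exact: measurableC.
- by move=> u _; rewrite lee_fin chiF0.
- by rewrite disj_set2E setICr.
Qed.

Lemma campbell_on_bigcup chi (E : (set (measurableTypeR R))^nat) z : (forall u, 0 <= chi u)%R ->
  (forall n, measurable (E n)) -> trivIset setT E ->
  campbell_on chi (\bigcup_k E k) z = \sum_(n <oo) campbell_on chi (E n) z.
Proof.
move=> chi0 mE tE; rewrite /campbell_on ge0_integral_bigcup//.
- apply: measurable_funTS; exact: (mEk chi z).
- by move=> u _; rewrite lee_fin chiF0.
Qed.

Definition ray_test chi (a : R) n : test := test_mul chi (@continuous_ramp_sub R n a).

Lemma ray_test_ge0 chi a n : (forall u, 0 <= chi u)%R ->
  forall u, (0 <= ray_test chi a n u)%R.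
Proof. by move=> chi0 u; rewrite /= mulr_ge0// ramp_ge0. Qed.

Lemma cvg_campbell_on_ray chi a z : (forall u, 0 <= chi u)%R ->
  campbell_on (ray_test chi a n) setT z @[n --> \oo] --> campbell_on chi `]a, +oo[%classic z.
Proof.
move=> chi0.
have := @cvg_integral_ray R z a (fun u => chi u * F (shift_measure u z))%R
  (@mchi chi z) (fun u => chiF0 z u chi0).
by rewrite /campbell_on/=; under eq_fun do under eq_integral do rewrite mulrCA mulrA.
Qed.

Lemma campbell_on_ray_nd chi a z : (forall u, 0 <= chi u)%R ->
  nondecreasing_seq (fun n => campbell_on (ray_test chi a n) setT z).
Proof.
move=> chi0 n m nm; apply: ge0_le_integral => //.
- by move=> u _; rewrite lee_fin; exact: (chiF0 z u (ray_test_ge0 a n chi0)).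
- by move=> u _; rewrite lee_fin ler_wpM2r// ler_wpM2l// le_ramp.
Qed.

(** The rays are the monotone limits of the continuous cut-offs, for which the
Campbell functional is continuous in z; the other Borel sets follow by monotone class. *)
Lemma measurable_campbell_on chi A : (forall u, 0 <= chi u)%R -> measurable A ->
  measurable_fun [set: lf] (campbell_on chi A).
Proof.
move=> chi0; move: A; apply: borel_induction.
- exact: measurable_campbell_onT.
- move=> a; apply: emeasurable_fun_cvg => [n|z _]; last exact: cvg_campbell_on_ray.
  by apply: measurable_campbell_onT; exact: ray_test_ge0.
- move=> S mS PS.
  rewrite (_ : campbell_on chi (~` S) = campbell_on chi setT \- campbell_on chi S).
    by apply: emeasurable_funB => //; exact: measurable_campbell_onT.
  by apply/funext => z; rewrite (campbell_onC z chi0 mS) addeAC subee ?add0e// campbell_on_fin.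
- move=> E mE tE PE.
  rewrite (_ : campbell_on chi _ = fun z => \sum_(n <oo) campbell_on chi (E n) z); last first.
    by apply/funext => z; exact: campbell_on_bigcup.
  by apply: ge0_emeasurable_sum => // k z _ _; exact: campbell_on_ge0.
Qed.

Variables (d : measure_display) (Om : measurableType d) (P : {measure set Om -> \bar R}).
Variable xi : Om -> lf.
Hypothesis mxi : measurable_fun setT xi.
Variable c : R.
Hypothesis mean_campbell : forall chi, (forall u, 0 <= chi u)%R ->
  \int[P]_w (campbell chi F (xi w))%:E = c%:E * \int[lebesgue_measure]_u (chi u)%:E.

Let mcampbell_on chi A : (forall u, 0 <= chi u)%R -> measurable A ->
  measurable_fun setT (fun w => campbell_on chi A (xi w)).
Proof. by move=> chi0 mA; exact: measurableT_comp (measurable_campbell_on chi0 mA) mxi. Qed.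

Let meanT chi : (forall u, 0 <= chi u)%R ->
  \int[P]_w campbell_on chi setT (xi w) = c%:E * \int[lebesgue_measure]_u (chi u)%:E.
Proof. by move=> chi0; under eq_integral do rewrite campbell_onT; exact: mean_campbell. Qed.

Let mEchi chi D : measurable_fun D (EFin \o chi : measurableTypeR R -> \bar R).
Proof. by apply: measurable_funTS; apply/measurable_EFinP; exact: measurable_test. Qed.

(** Both sides are finite measures in A that agree on open rays, by monotone
convergence of chi times a ramp. *)
Lemma mean_campbell_on chi A : (forall u, 0 <= chi u)%R -> measurable A ->
  \int[P]_w campbell_on chi A (xi w) = c%:E * \int[lebesgue_measure]_(u in A) (chi u)%:E.
Proof.
move=> chi0; move: A; apply: borel_induction.
- exact: meanT.
- move=> a.
  have h1 : \int[P]_w campbell_on (ray_test chi a n) setT (xi w) @[n --> \oo] -->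
      \int[P]_w campbell_on chi `]a, +oo[%classic (xi w).
    apply: cvg_integral_mono => //.
    + by move=> n; apply: mcampbell_on => //; exact: ray_test_ge0.
    + by move=> n w; apply: campbell_on_ge0; exact: ray_test_ge0.
    + by move=> w; exact: campbell_on_ray_nd.
    + by move=> w _; exact: cvg_campbell_on_ray.
  have h2 : c%:E * \int[lebesgue_measure]_u (ray_test chi a n u)%:E @[n --> \oo] -->
      c%:E * \int[lebesgue_measure]_(u in `]a, +oo[) (chi u)%:E.
    apply: cvgeZl => //.
    have := @cvg_integral_ray R lebesgue_measure a chi (measurable_test chi) chi0.
    by under eq_fun do under eq_integral do rewrite mulrC.
  apply: cvg_unique h1 _ => //.
  rewrite (_ : (fun n => _) = fun n =>
    c%:E * \int[lebesgue_measure]_u (ray_test chi a n u)%:E)//.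
  by apply/funext => n; apply: meanT; exact: ray_test_ge0.
- move=> S mS PS.
  have mSC := measurableC mS.
  have hT := meanT chi0.
  have : c%:E * \int[lebesgue_measure]_(u in S) (chi u)%:E +
     \int[P]_w campbell_on chi (~` S) (xi w) =
     c%:E * \int[lebesgue_measure]_(u in S) (chi u)%:E +
     c%:E * \int[lebesgue_measure]_(u in ~` S) (chi u)%:E.
    rewrite -PS -ge0_integralD//; last 4 first.
    + by move=> w _; exact: campbell_on_ge0.
    + exact: mcampbell_on.
    + by move=> w _; exact: campbell_on_ge0.
    + exact: mcampbell_on.
    rewrite PS -ge0_muleDr; last 2 first.
    + by apply: integral_ge0 => u _; rewrite lee_fin.
    + by apply: integral_ge0 => u _; rewrite lee_fin.
    rewrite -ge0_integral_setU//; last 3 first.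
    + exact: mEchi.
    + by move=> u _; rewrite lee_fin.
    + by rewrite disj_set2E setICr.
    by rewrite setUv -hT; apply: eq_integral => w _; rewrite -campbell_onC.
  have xfin : c%:E * \int[lebesgue_measure]_(u in S) (chi u)%:E \is a fin_num.
    apply: fin_numM => //; apply: integrable_fin_num => //.
    exact: integrableS (integrable_test lebesgue_lf chi).
  move=> /(congr1 (fun y => y - c%:E * \int[lebesgue_measure]_(u in S) (chi u)%:E)).
  by rewrite ![_ + _ - _]addeAC subee// !add0e.
- move=> E mE tE PE.
  under eq_integral do rewrite campbell_on_bigcup//.
  rewrite integral_nneseries//; last 2 first.
  + by move=> n; exact: (mcampbell_on chi0 (mE n)).
  + by move=> n w _; exact: campbell_on_ge0.
  rewrite ge0_integral_bigcup//; last 2 first.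
  + exact: mEchi.
  + by move=> u _; rewrite lee_fin.
  rewrite -nneseriesZl; first exact: eq_eseriesr.
  by move=> n _; apply: integral_ge0 => u _; rewrite lee_fin.
Qed.

(** Let chi increase to 1. *)
Lemma mean_shift_integral A : measurable A ->
  \int[P]_w \int[xi w]_(u in A) (F (shift_measure u (xi w)))%:E =
  c%:E * lebesgue_measure A.
Proof.
move=> mA.
pose chi n := cut_test n%:R : test.
have chi0 n u : (0 <= chi n u)%R by exact: cut_ge0.
have ndchi u n m : (n <= m)%N -> (chi n u <= chi m u)%R.
  by move=> nm; apply: le_cut; rewrite ler_nat.
have cchi u : chi n u @[n --> \oo] --> (1 : R)%R.
  apply: cvg_near_cst; exists (Num.truncn `|u|).+1 => // n /= un.
  apply: cut1; apply: le_trans (ltW (truncnS_gt _)) _.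
  by rewrite ler_nat.
have ccvg z : campbell_on (chi n) A z @[n --> \oo] -->
    \int[z]_(u in A) (F (shift_measure u z))%:E.
  apply: cvg_integral_mono => //.
  - by move=> n; apply: measurable_funTS; exact: mEk.
  - by move=> n u; rewrite lee_fin; exact: chiF0.
  - by move=> u n m nm; rewrite lee_fin ler_wpM2r// ndchi.
  - move=> u _; apply: cvg_EFin; first exact: nearW.
    by rewrite -[X in _ --> X]mul1r; apply: cvgM; [exact: cchi|exact: cvg_cst].
have h1 : \int[P]_w campbell_on (chi n) A (xi w) @[n --> \oo] -->
    \int[P]_w \int[xi w]_(u in A) (F (shift_measure u (xi w)))%:E.
  apply: cvg_integral_mono => //.
  - by move=> n; exact: mcampbell_on.
  - by move=> n w; exact: campbell_on_ge0.
  - move=> w n m nm; apply: ge0_le_integral => //.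
    + by move=> u _; rewrite lee_fin; exact: chiF0.
    + by apply: measurable_funTS; exact: mEk.
    + by apply: measurable_funTS; exact: mEk.
    + by move=> u _; rewrite lee_fin ler_wpM2r// ndchi.
have h2 : c%:E * \int[lebesgue_measure]_(u in A) (chi n u)%:E @[n --> \oo] -->
    c%:E * lebesgue_measure A.
  apply: cvgeZl => //.
  rewrite -[lebesgue_measure A]mul1e -integral_cst//.
  apply: cvg_integral_mono => //.
  - by move=> n; exact: mEchi.
  - by move=> u _; apply: cvg_EFin; [exact: nearW|exact: cchi].
apply: cvg_unique h1 _ => //.
rewrite (_ : (fun n => _) = fun n =>
  c%:E * \int[lebesgue_measure]_(u in A) (chi n u)%:E)//.
by apply/funext => n; exact: mean_campbell_on.
Qed.
End campbell_measure.

(** * The hitting process as a series of unit masses *)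

Section hitting_series.
Context {d : measure_display} {Y : measurableType d} {R : realType}.
Local Open Scope ring_scope.
Local Open Scope ereal_scope.
Variables (T : Y -> Y) (r : Y -> R).
Hypothesis r_gt0 : (0 < inf (range r))%R.
Variable D : set Y.
Local Notation S n y := (birkhoff_sum T r n y).
Local Notation X := (suspension r_gt0).
Local Notation P x := (hitting_process T D (x : X)).
Local Notation rho := (inf (range r)).

(** The orbit of (y, s) meets the base for the (n + 1)-st time at S_(n+1)(y) - s. *)
Definition visit_time (x : X) (n : nat) : R := (S n.+1 (val x).1 - ((val x).2 : R))%R.

Lemma birkhoff_sum0 y : S 0 y = 0%R.
Proof. by rewrite /birkhoff_sum big_ord0. Qed.

Lemma birkhoff_sum_add n m y : S (n + m) y = (S n y + S m (iter n T y))%R.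
Proof.
elim: m => [|m ih]; first by rewrite addn0 birkhoff_sum0 addr0.
by rewrite addnS !birkhoff_sumS ih addrA addnC iterD.
Qed.

Lemma birkhoff_sum_ltn n m y : (n < m)%N -> (S n y < S m y)%R.
Proof.
move=> nm; have -> : m = (n + (m - n))%N by lia.
rewrite birkhoff_sum_add ltrDl; apply: lt_le_trans (birkhoff_sum_ge _ r_gt0 _ _).
by rewrite pmulrn_lgt0// subn_gt0.
Qed.

Lemma visit_time_gap x n j : (rho *+ j + visit_time x n <= visit_time x (n + j))%R.
Proof.
rewrite /visit_time -addSn birkhoff_sum_add.
have := birkhoff_sum_ge T r_gt0 j (iter n.+1 T (val x).1); lra.
Qed.

Lemma visit_time_gt x n : (rho *+ n < visit_time x n)%R.
Proof.
have := visit_time_gap x 0 n; rewrite add0n; apply: lt_le_trans.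
rewrite ltrDl /visit_time birkhoff_sumS birkhoff_sum0 add0r subr_gt0.
by case/andP: (valP x).
Qed.

Lemma visit_time_gt0 x n : (0 < visit_time x n)%R.
Proof.
by apply: le_lt_trans (visit_time_gt x n); rewrite mulrn_wge0// ltW.
Qed.

Lemma visit_time_inj x : injective (visit_time x).
Proof.
move=> n m /eqP; rewrite /visit_time (inj_eq (addIr _)) => /eqP h.
apply/eqP; rewrite eqn_leq [(n <= m)%N]leqNgt [(m <= n)%N]leqNgt.
by apply/andP; split; apply/negP => nm;
  have := @birkhoff_sum_ltn _ _ (val x).1 (nm : (_.+1 < _.+1)%N); rewrite h ltxx.
Qed.

(** The orbit is in the base exactly when s + t is a Birkhoff sum S_n(y), and n > 0
since t > 0. *)
Lemma hitting_times_visit x :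
  hitting_times T D x = visit_time x @` [set n | D (iter n.+1 T (val x).1)].
Proof.
have /andP[s0 sr] := valP x.
apply/seteqP; split => t.
- move=> [t0 [/= Dt]].
  have [n nP] := birkhoff_sum_ex T r_gt0 (val x).1 (addr_ge0 s0 (ltW t0)).
  move: Dt; rewrite (flowE nP)/= => Dn /eqP; rewrite subr_eq0 => /eqP tE.
  case: n => [|n] in nP Dn tE *.
    move: tE; rewrite birkhoff_sum0 => tE.
    have : (0 < ((val x).2 : R) + t)%R by rewrite ltr_wpDl.
    by rewrite tE ltxx.
  by exists n => //; rewrite /visit_time -tE addrC addKr.
- move=> [n /= Dn <-]; split; first exact: visit_time_gt0.
  have h : (((val x).2 : R) + visit_time x n = S n.+1 (val x).1)%R.
    by rewrite /visit_time addrC subrK.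
  rewrite (@flowE _ _ _ T r r_gt0 n.+1)/=.
    by split => //=; rewrite h subrr.
  by rewrite h lexx/= birkhoff_sum_ltn.
Qed.

Definition visit_measure (x : X) (n : nat) : {measure set (measurableTypeR R) -> \bar R} :=
  if pselect (D (iter n.+1 T (val x).1)) then
    [the {measure set (measurableTypeR R) -> \bar R} of \d_(visit_time x n : measurableTypeR R)]
  else [the {measure set (measurableTypeR R) -> \bar R} of mzero].

Lemma hitting_process_series x (A : set (measurableTypeR R)) :
  P x A = mseries (visit_measure x) 0 A.
Proof.
rewrite /= dirac_sumE /mseries hitting_times_visit.
rewrite (_ : _ `&` A = visit_time x @`
    [set n | D (iter n.+1 T (val x).1) /\ A (visit_time x n)]); last first.
  apply/seteqP; split => t.
    by move=> [[n /= Dn <-] At]; exists n.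
  by move=> [n /= [Dn At] <-]; split => //; exists n.
rewrite (@reindex_esum _ _ _ [set n | D (iter n.+1 T (val x).1) /\ A (visit_time x n)] _
  (visit_time x)); last first.
  by split => // n m _ _; exact: visit_time_inj.
rewrite esum_mkcond nneseries_esumT => [|n]; last exact: measure_ge0.
apply: eq_esum => n _; rewrite /visit_measure; case: ifPn => [/set_mem[Dn An]|].
  by case: pselect => //= ?; rewrite diracE mem_set.
move/negP => nDA; case: pselect => //= Dn; rewrite diracE memNset//.
by move=> An; apply: nDA; exact/mem_set.
Qed.

Lemma integral_hitting_process x (A : set R) (h : R -> \bar R) :
  measurable A -> measurable_fun A h -> (forall t, 0 <= h t) ->
  \int[P x]_(t in A) h t =
  \sum_(0 <= n <oo) (\1_D (iter n.+1 T (val x).1) * \1_A (visit_time x n))%:E * h (visit_time x n).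
Proof.
move=> mA mh h0.
rewrite (eq_measure_integral [the measure _ _ of mseries (visit_measure x) 0]); last first.
  by move=> B mB _; exact: hitting_process_series.
rewrite ge0_integral_measure_series//; apply: eq_eseriesr => n _.
rewrite /visit_measure; case: pselect => Dn; last first.
  by rewrite integral_measure_zero indicE memNset ?mul0r ?mul0e.
rewrite (indicE _ D) mem_set// mul1r integral_mkcond.
rewrite integral_dirac//; last first.
  by apply/(measurable_restrictT _ _).1.
rewrite diracT mul1e patchE indicE; case: ifPn; rewrite ?mul1e ?mul0e//.
Qed.

Lemma integral_hitting_processT x (h : R -> \bar R) :
  measurable_fun [set: measurableTypeR R] h -> (forall t, 0 <= h t) ->
  \int[P x]_t h t =
  \sum_(0 <= n <oo) (\1_D (iter n.+1 T (val x).1))%:E * h (visit_time x n).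
Proof.
move=> mh h0; rewrite integral_hitting_process//.
by apply: eq_eseriesr => n _; rewrite indicT mulr1.
Qed.

Lemma hitting_process_sum x (A : set (measurableTypeR R)) : P x A =
  \sum_(0 <= n <oo) (\1_D (iter n.+1 T (val x).1) * \1_A (visit_time x n))%:E.
Proof.
rewrite hitting_process_series; apply: eq_eseriesr => n _.
rewrite /visit_measure; case: pselect => Dn /=; last first.
  by rewrite (indicE _ D) memNset ?mul0r.
by rewrite (indicE _ D) mem_set// mul1r.
Qed.

(** Seen from its n-th visit to the base, if only the future is observed, the orbit
of x is the orbit of the point of the base that is visited.  The shift comes in two
steps v and w because of the way the Campbell functional composes shifts. *)
Lemma shift_hitting_process x n v w (A : set R) : A `<=` [set t | (0 < t)%R] ->
  (v + w = visit_time x n)%R ->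
  shift_measure v (shift_measure w (P x)) A = P (base r_gt0 (iter n.+1 T (val x).1)) A.
Proof.
move=> A0 vw; rewrite !shift_measureE !hitting_process_sum.
(* the visits up to the n-th one are not in the future of the n-th one *)
rewrite (nneseries_split 0 n.+1); last by move=> k _; rewrite lee_fin mulr_ge0.
rewrite big1_seq ?add0e; last first.
  move=> k /andP[_]; rewrite mem_index_iota add0n => /andP[_ kn].
  rewrite [X in (_ * X)%R]indicE memNset ?mulr0// => /A0 /=.
  rewrite -addrA -opprD (addrC w) vw subr_gt0 ltNge => /negP; apply.
  rewrite -(subnKC (kn : (k <= n)%N)).
  by apply: le_trans (visit_time_gap _ _ _); rewrite lerDr mulrn_wge0// ltW.
rewrite add0n -nneseries_addn; last by move=> k; rewrite lee_fin mulr_ge0.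
apply: eq_eseriesr => k _; congr (_%:E); congr (_ * _)%R.
  by rewrite -addSn iterD.
rewrite !indicE; congr ((_ : bool)%:R)%R.
have -> : visit_time (base r_gt0 (iter n.+1 T (val x).1)) k =
    (visit_time x (k + n.+1) - w - v)%R.
  rewrite -addrA -opprD (addrC w) vw /visit_time /base/= subr0.
  rewrite -[in RHS]addSn addnC birkhoff_sum_add; ring.
by apply/idP/idP => /set_mem ?; exact/mem_set.
Qed.

End hitting_series.

(** * Campbell functionals of the hitting process *)

Section hitting_campbell.
Context {d : measure_display} {Y : measurableType d} {R : realType}.
Local Open Scope ring_scope.
Local Open Scope ereal_scope.
Variables (T : Y -> Y) (r : Y -> R).
Hypothesis r_gt0 : (0 < inf (range r))%R.
Variable D : set Y.
Local Notation S n y := (birkhoff_sum T r n y).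
Local Notation X := (suspension r_gt0).
Local Notation P x := (hitting_process T D (x : X)).
Local Notation rho := (inf (range r)).
Local Notation lf := (lfmeasure R).

Variable F : lf -> R.
Hypothesis F_continuous : continuous F.
Hypothesis F_ge0 : forall z, (0 <= F z)%R.
Hypothesis F_le1 : forall z, (F z <= 1)%R.
Hypothesis F_restr : forall z1 z2 : lf, (forall A : set R, measurable A ->
  A `<=` [set t | (0 < t)%R] -> z1 A = z2 A) -> F z1 = F z2.
Variable chi : test_function R.
Hypothesis chi_ge0 : forall u, (0 <= chi u)%R.

(** The contribution to the Campbell functional of a visit to the point y of the
base: a visit outside D is not a point of the process. *)
Definition return_weight (y : Y) : R := (\1_D y * F (P (base r_gt0 y)))%R.
Local Notation k := return_weight.

Lemma return_weight_ge0 y : (0 <= k y)%R.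
Proof. by rewrite mulr_ge0. Qed.

Lemma return_weight_le1 y : (k y <= 1)%R.
Proof.
rewrite /k indicE; case: (_ \in _); rewrite ?mul1r ?mul0r//.
Qed.

(** The functional F only sees the future of each visit, which is the hitting
process of the visited point of the base. *)
Lemma campbell_hitting x v : (campbell chi F (shift_measure v (P x)))%:E =
  \sum_(0 <= n <oo) (k (iter n.+1 T (val x).1) * chi (visit_time T x n - v))%:E.
Proof.
rewrite -(campbell_onT F_continuous) /campbell_on.
have mk : measurable_fun [set: measurableTypeR R]
    (fun u => (chi u * F (shift_measure u (shift_measure v (P x))))%:E).
  apply/measurable_EFinP; apply: continuous_measurable_fun => u.
  exact: campbell_test_continuous.
have k0 u : 0 <= (chi u * F (shift_measure u (shift_measure v (P x))))%:E.
  by rewrite lee_fin mulr_ge0.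
rewrite (ge0_integral_shift _ _ measurableT mk k0) preimage_setT.
rewrite integral_hitting_processT; last 2 first.
- exact: measurableT_comp mk (measurable_subr v).
- by move=> t; exact: k0.
apply: eq_eseriesr => n _; rewrite /k !indicE.
case: (_ \in D); last by rewrite !mul0r mul0e.
rewrite mul1e mul1r mulrC; congr ((_ * _)%:E)%R; apply: F_restr => A mA A0.
by apply: shift_hitting_process => //; rewrite subrK.
Qed.

Lemma sum_window (n0 K N : nat) :
  (\sum_(n < N) (n0 <= n < n0 + K) <= K)%N.
Proof.
suff -> : (\sum_(n < N) (n0 <= n < n0 + K) = minn N (n0 + K) - minn N n0)%N by lia.
elim: N => [|N ih]; first by rewrite big_ord0; lia.
by rewrite big_ord_recr/= ih; lia.
Qed.

(** Visits are separated by the infimum of the roof, so at most K of them are in a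
window of the length of the support of chi, wherever the window is. *)
Lemma campbell_bounded :
  exists C : R, forall x v, (campbell chi F (shift_measure v (P x)) <= C)%R.
Proof.
have [M M0 hM] := test_supp chi; have [C C0 hC] := test_bounded chi.
(* K gaps between visits exceed the length 2 M of the support of chi *)
pose K := (Num.truncn (2 * M / rho)).+1%R.
exists (C * K%:R)%R => x v; rewrite -lee_fin campbell_hitting.
have t0 n : 0 <= (k (iter n.+1 T (val x).1) * chi (visit_time T x n - v))%:E.
  by rewrite lee_fin mulr_ge0// return_weight_ge0.
have CK : (0 <= C * K%:R)%R by rewrite mulr_ge0// ltW.
have [[n0' hn0']|none] := pselect (exists n, `|visit_time T x n - v| <= M)%R; last first.
  rewrite eseries0 ?lee_fin// => n _ _; rewrite hM ?mulr0// ltNge.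
  by apply/negP => nM; apply: none; exists n.
have ex : exists n, (`|visit_time T x n - v| <= M)%R by exists n0'.
case: (ex_minnP ex) => n0 hn0 min0.
apply: lime_le; first exact: is_cvg_nneseries.
apply: nearW => N; rewrite big_mkord sumEFin lee_fin.
apply: (@le_trans _ _ (\sum_(n < N) C * (n0 <= n < n0 + K)%N%:R)%R); last first.
  rewrite -mulr_sumr; apply: ler_wpM2l; first exact: ltW.
  by rewrite -natr_sum ler_nat sum_window.
apply: ler_sum => n _.
have [xM|xM] := leP `|visit_time T x n - v|%R M; last first.
  by rewrite hM// mulr0 mulr_ge0// ltW.
have n0n : (n0 <= n)%N by exact: min0.
have nK : (n < n0 + K)%N.
  rewrite ltnNge; apply/negP => Kn.
  have := visit_time_gap T x n0 (n - n0); rewrite subnKC//.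
  have : (2 * M < rho *+ (n - n0))%R.
    rewrite -[X in (_ < X)%R]mulr_natl -ltr_pdivrMr//.
    apply: lt_le_trans (truncnS_gt _) _; rewrite ler_nat -/K; lia.
  move: xM hn0; rewrite !ler_norml; lra.
rewrite n0n nK mulr1 -[leRHS]mul1r.
apply: ler_pM => //; first exact: return_weight_ge0.
- exact: return_weight_le1.
- exact: le_trans (ler_norm _) (hC _).
Qed.

Variable mu : probability Y R.
Hypothesis T_measurable : measurable_fun [set: Y] T.
Hypothesis T_invariant : forall A : set Y, measurable A -> mu (T @^-1` A) = mu A.
Hypothesis r_integrable : mu.-integrable [set: Y] (EFin \o r).
Hypothesis D_measurable : measurable D.

Lemma measurable_iter n : measurable_fun [set: Y] (iter n T).
Proof.
elim: n => [|n ih]; first exact: measurable_id.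
exact: measurableT_comp T_measurable ih.
Qed.

Lemma measurable_birkhoff_sum n : measurable_fun [set: Y] (birkhoff_sum T r n).
Proof.
have mr : measurable_fun [set: Y] r.
  by apply/measurable_EFinP; exact: measurable_int r_integrable.
rewrite (_ : birkhoff_sum T r n = fun y => \sum_(j < n) r (iter j T y))%R//.
apply: measurable_sum => j.
exact: measurableT_comp mr (measurable_iter j).
Qed.

Lemma measurable_hitting_base : measurable_fun [set: Y] (fun y => P (base r_gt0 y) : lf).
Proof.
apply: measurable_fun_lf => j; rewrite /Rintegral.
apply: measurableT_comp => //.
rewrite (_ : (fun y => _) = fun y =>
   \sum_(0 <= n <oo) (\1_D (iter n.+1 T y) * tent j (S n.+1 y))%:E); last first.
  apply/funext => y; rewrite integral_hitting_processT.
  - by apply: eq_eseriesr => n _; rewrite /visit_time/= subr0.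
  - apply/measurable_EFinP; exact: (measurable_test (tent_test j)).
  - by move=> t; rewrite lee_fin tent_ge0.
apply: ge0_emeasurable_sum => [n y _ _|n _]; first by rewrite lee_fin mulr_ge0// tent_ge0.
apply/measurable_EFinP; apply: measurable_funM.
  exact: measurableT_comp (measurable_indic D_measurable) (measurable_iter n.+1).
exact: measurableT_comp (measurable_test (tent_test j)) (measurable_birkhoff_sum n.+1).
Qed.

Lemma measurable_return_weight : measurable_fun [set: Y] k.
Proof.
apply: measurable_funM => //.
exact: measurableT_comp (continuous_lf_measurable F_continuous) measurable_hitting_base.
Qed.

Lemma measurable_suspension_val : measurable_fun [set: X] (fun x : X => val x).
Proof. by move=> _ B mB; rewrite setTI; exists B => //; rewrite setTI. Qed.

Lemma measurable_campbell_hitting v :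
  measurable_fun [set: X] (fun x => campbell chi F (shift_measure v (P x))).
Proof.
apply/measurable_EFinP.
rewrite (_ : EFin \o _ = fun x => \sum_(0 <= n <oo)
    (k (iter n.+1 T (val x).1) * chi (visit_time T x n - v))%:E); last first.
  by apply/funext => x; exact: campbell_hitting.
have m1 : measurable_fun [set: X] (fun x : X => (val x).1).
  exact: measurableT_comp measurable_fst measurable_suspension_val.
have m2 : measurable_fun [set: X] (fun x : X => (val x).2).
  exact: measurableT_comp measurable_snd measurable_suspension_val.
apply: ge0_emeasurable_sum => [n y _ _|n _].
  by rewrite lee_fin mulr_ge0// return_weight_ge0.
apply/measurable_EFinP; apply: measurable_funM.
  apply: measurableT_comp measurable_return_weight _.
  exact: measurableT_comp (measurable_iter n.+1) m1.
apply: (measurableT_comp (measurable_test chi)).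
apply: measurable_funB => //; apply: measurable_funB => //.
exact: measurableT_comp (measurable_birkhoff_sum n.+1) m1.
Qed.

End hitting_campbell.

(** * Averages over the suspension *)

Section lebesgue_reflection.
Context {R : realType}.
Local Open Scope ring_scope.
Local Open Scope ereal_scope.

Lemma measurable_reflection (c : R) :
  measurable_fun [set: measurableTypeR R] (fun s : R => (c - s)%R : measurableTypeR R).
Proof. exact: measurable_funB. Qed.

(** Half-open intervals are exchanged with intervals of the same length. *)
Lemma lebesgue_measure_reflection (c : R) (A : set R) : measurable A ->
  lebesgue_measure ((fun s : R => (c - s)%R) @^-1` A) = lebesgue_measure A.
Proof.
move=> mA; apply/esym.
have := @lebesgue_measure_unique R
  [the measure _ _ of pushforward lebesgue_measure (fun s : R => (c - s)%R : measurableTypeR R)].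
apply => //; first exact: measurable_reflection.
move=> mf _ [[a b]] _ <-.
transitivity (lebesgue_measure `[(c - b)%R, (c - a)%R[%classic); last first.
  congr (lebesgue_measure _); apply/seteqP; split => x /=; rewrite !in_itv/=;
    move=> /andP[? ?]; apply/andP; split; lra.
rewrite /= !lebesgue_measure_itv/= !lte_fin ltrD2l ltrN2.
by case: ifP => // _; rewrite -!EFinD; congr (_%:E); ring.
Qed.

Lemma ge0_integral_reflection (c : R) (A : set R) (g : R -> \bar R) :
  measurable A -> measurable_fun A g -> (forall b, 0 <= g b) ->
  \int[lebesgue_measure]_(s in (fun s : R => (c - s)%R) @^-1` A) g (c - s)%R =
  \int[lebesgue_measure]_(b in A) g b.
Proof.
move=> mA mg g0.
rewrite -(ge0_integral_pushforward (measurable_reflection c) lebesgue_measure mA mg)//.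
apply: eq_measure_integral; first exact: measurable_reflection.
by move=> mf B mB _; exact: lebesgue_measure_reflection.
Qed.

(** A translation is the composition of two reflections. *)
Lemma ge0_integral_translation (v : R) (g : R -> \bar R) :
  measurable_fun [set: R] g -> (forall b, 0 <= g b) ->
  \int[lebesgue_measure]_b g (b - v)%R = \int[lebesgue_measure]_b g b.
Proof.
move=> mg g0.
rewrite -(@ge0_integral_reflection (- v) setT g)// preimage_setT.
rewrite -(@ge0_integral_reflection 0 setT (fun b => g (b - v)%R))//; last first.
  exact: measurableT_comp mg (measurable_subr v).
by rewrite preimage_setT; apply: eq_integral => s _; congr g; ring.
Qed.

End lebesgue_reflection.

Section cumulative.
Context {R : realType}.
Local Open Scope ring_scope.
Local Open Scope ereal_scope.
Variables (chi : test_function R) (v : R).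
Hypothesis chi_ge0 : forall u, (0 <= chi u)%R.

Let mchi (D : set R) : measurable_fun D (fun b => (chi (b - v))%:E).
Proof.
apply: measurable_funTS; apply/measurable_EFinP.
exact: (measurable_test (test_shift chi v)).
Qed.

(** As S_0 = 0, integrating from 0 makes the first boundary term of the telescoping
sum vanish. *)
Definition cumulative (t : R) : R := (\int[lebesgue_measure]_(b in `[0%R, t[) chi (b - v))%R.

Lemma cumulativeE t :
  (cumulative t)%:E = \int[lebesgue_measure]_(b in `[0%R, t[) (chi (b - v))%:E.
Proof.
rewrite /cumulative /Rintegral fineK//; apply: integrable_fin_num => //.
exact: integrableS (integrable_test lebesgue_lf (test_shift chi v)).
Qed.

Lemma le_cumulative s t : (s <= t)%R -> (cumulative s <= cumulative t)%R.
Proof.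
move=> st; rewrite -lee_fin !cumulativeE; apply: ge0_subset_integral => //.
- exact: mchi.
- by move=> b _; rewrite lee_fin.
- by apply: subset_itvl; rewrite bnd_simp.
Qed.

Lemma cumulative_ge0 t : (0 <= cumulative t)%R.
Proof. exact: Rintegral_ge0. Qed.

Lemma measurable_cumulative : measurable_fun [set: R] cumulative.
Proof. exact: (nondecreasing_measurable measurableT (fun s t => @le_cumulative s t)). Qed.

Lemma cumulative0 : cumulative 0 = 0%R.
Proof. by rewrite /cumulative set_itvco0 Rintegral_set0. Qed.

(** The substitution b = a + l - s maps [0, l[ to ]a, a + l]. *)
Lemma cumulativeD a l : (0 <= a)%R -> (0 <= l)%R ->
  (cumulative (a + l))%:E = (cumulative a)%:E +
  \int[lebesgue_measure]_(s in `[0%R, l[) (chi (a + l - s - v))%:E.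
Proof.
move=> a0 l0; rewrite !cumulativeE.
have -> : \int[lebesgue_measure]_(s in `[0%R, l[) (chi (a + l - s - v))%:E =
    \int[lebesgue_measure]_(b in `]a, (a + l)%R]) (chi (b - v))%:E.
  rewrite -(@ge0_integral_reflection R (a + l) `]a, (a + l)%R]%classic)//; last first.
    by move=> b; rewrite lee_fin.
  congr (integral _ _ _); apply/seteqP; split => s /=; rewrite !in_itv/=;
    move=> /andP[? ?]; apply/andP; split; lra.
have -> : \int[lebesgue_measure]_(b in `]a, (a + l)%R]) (chi (b - v))%:E =
    \int[lebesgue_measure]_(b in `[a, (a + l)%R[) (chi (b - v))%:E.
  by rewrite (@integral_itv_bndoo _ a (a + l)%R _ false false)
    ?(@integral_itv_bndoo _ a (a + l)%R _ true true).
rewrite -ge0_integral_setU//; last 3 first.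
- exact: mchi.
- by move=> b _; rewrite lee_fin.
- rewrite disj_set2E; apply/eqP/seteqP; split => // b [] /=; rewrite !in_itv/=.
  by move=> /andP[_ ba] /andP[ab _]; move: ab; rewrite leNgt ba.
congr (integral _ _ _); apply/seteqP; split => b /=; rewrite !in_itv/=.
  by move=> /andP[b0 bal]; have [ba|ba] := ltP b a; [left|right]; rewrite ?b0 ?bal.
by move=> [|] /andP[? ?]; apply/andP; split; lra.
Qed.

Lemma cumulative_large M t : (forall x, M < `|x| -> chi x = 0)%R ->
  (M <= v)%R -> (v + M < t)%R -> (cumulative t)%:E = \int[lebesgue_measure]_u (chi u)%:E.
Proof.
move=> hM Mv vt; rewrite cumulativeE.
have mE : measurable_fun [set: R] (fun b => (chi b)%:E).
  by apply/measurable_EFinP; exact: measurable_test.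
rewrite -(ge0_integral_translation v mE); last by move=> b; rewrite lee_fin.
rewrite integral_mkcond; apply: eq_integral => b _; rewrite patchE.
case: ifPn => // /negP bt; rewrite hM//.
rewrite ltNge; apply/negP; rewrite ler_norml => /andP[h1 h2]; apply: bt.
by apply/mem_set => /=; rewrite in_itv/=; apply/andP; split; lra.
Qed.

End cumulative.

Section suspension_mean.
Context {d : measure_display} {Y : measurableType d} {R : realType}.
Local Open Scope ring_scope.
Local Open Scope ereal_scope.
Variables (mu : probability Y R) (T : Y -> Y) (r : Y -> R).
Hypothesis T_measurable : measurable_fun [set: Y] T.
Hypothesis T_invariant : forall A : set Y, measurable A -> mu (T @^-1` A) = mu A.
Hypothesis r_integrable : mu.-integrable [set: Y] (EFin \o r).
Hypothesis r_gt0 : (0 < inf (range r))%R.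
Variable D : set Y.
Hypothesis D_measurable : measurable D.
Local Notation S n y := (birkhoff_sum T r n y).
Local Notation X := (suspension r_gt0).
Local Notation P x := (hitting_process T D (x : X)).
Local Notation rho := (inf (range r)).
Local Notation lf := (lfmeasure R).

Lemma invariant_integral (g : Y -> \bar R) : measurable_fun setT g ->
  (forall y, 0 <= g y) -> \int[mu]_y g (T y) = \int[mu]_y g y.
Proof.
move=> mg g0.
have := ge0_integral_pushforward T_measurable mu measurableT mg (fun y _ => g0 y).
rewrite preimage_setT => <-; apply: eq_measure_integral => A mA _.
exact: T_invariant.
Qed.

Lemma invariant_integral_iter n (g : Y -> \bar R) : measurable_fun setT g ->
  (forall y, 0 <= g y) -> \int[mu]_y g (iter n T y) = \int[mu]_y g y.
Proof.
move=> mg g0; elim: n => [//|n ih].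
rewrite -[RHS]ih -[RHS]invariant_integral//; last first.
  exact: measurableT_comp mg (measurable_iter T_measurable n).
by apply: eq_integral => y _; rewrite iterSr.
Qed.

Variable F : lf -> R.
Hypothesis F_continuous : continuous F.
Hypothesis F_ge0 : forall z, (0 <= F z)%R.
Hypothesis F_restr : forall z1 z2 : lf, (forall A : set R, measurable A ->
  A `<=` [set t | (0 < t)%R] -> z1 A = z2 A) -> F z1 = F z2.
Variable chi : test_function R.
Hypothesis chi_ge0 : forall u, (0 <= chi u)%R.
Local Notation k := (return_weight T r_gt0 D F).

Let mk : measurable_fun setT k.
Proof.
exact: (measurable_return_weight r_gt0 F_continuous T_measurable r_integrable D_measurable).
Qed.

Let k0 y : (0 <= k y)%R.
Proof. exact: return_weight_ge0. Qed.

Variable v : R.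
Local Notation X_ := (cumulative chi v).

(** The integral over the fibre above y of the n-th term of the Campbell functional,
without its weight. *)
Let roof_integral n y := \int[lebesgue_measure]_(s in `[0%R, r y[) (chi (S n.+1 y - s - v))%:E.

Let S_ge0 n y : (0 <= S n y)%R.
Proof. by apply: le_trans (birkhoff_sum_ge T r_gt0 n y); rewrite mulrn_wge0// ltW. Qed.

Let cumulative_roof_integral n y : (X_ (S n.+1 y))%:E = (X_ (S n (T y)))%:E + roof_integral n y.
Proof.
have SE : S n.+1 y = (S n (T y) + r y)%R.
  by rewrite -add1n birkhoff_sum_add birkhoff_sumS birkhoff_sum0 add0r addrC.
by rewrite /roof_integral SE cumulativeD// ltW// roof_gt0.
Qed.

Let roof_integralE n y : roof_integral n y = (X_ (S n.+1 y) - X_ (S n (T y)))%:E.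
Proof. by rewrite EFinB cumulative_roof_integral addeAC subee// add0e. Qed.

Let roof_integral_ge0 n y : 0 <= roof_integral n y.
Proof. by apply: integral_ge0 => s _; rewrite lee_fin. Qed.

Let mXS n : measurable_fun setT (fun y => X_ (S n y)).
Proof.
apply: (measurableT_comp (measurable_cumulative v chi_ge0)).
exact: (measurable_birkhoff_sum T_measurable r_integrable n).
Qed.

Let measurable_roof_integral n : measurable_fun setT (roof_integral n).
Proof.
rewrite (_ : roof_integral n = fun y => (X_ (S n.+1 y) - X_ (S n (T y)))%:E); last first.
  by apply/funext => y; exact: roof_integralE.
apply/measurable_EFinP; apply: measurable_funB => //.
exact: measurableT_comp (mXS n) T_measurable.
Qed.

Let mkT n : measurable_fun setT (fun y => k (iter n T y)).
Proof. exact: measurableT_comp mk (measurable_iter T_measurable n). Qed.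

(** The mean of the n-th term of the Campbell functional is the difference of the
boundary means of indices n.+1 and n. *)
Let boundary_mean n := \int[mu]_y (k (iter n T y) * X_ (S n y))%:E.

Let crossing_mean n := \int[mu]_y ((k (iter n.+1 T y))%:E * roof_integral n y).

(** Invariance of mu replaces y by T y in the boundary mean of index n, and the two
boundary means then differ by the integral over the fibre. *)
Let boundary_meanS n : boundary_mean n.+1 = boundary_mean n + crossing_mean n.
Proof.
rewrite /boundary_mean.
rewrite -[\int[mu]_y (k (iter n T y) * X_ (S n y))%:E]invariant_integral; last 2 first.
- by apply/measurable_EFinP; exact: measurable_funM.
- by move=> y; rewrite lee_fin mulr_ge0// cumulative_ge0.
rewrite /crossing_mean -ge0_integralD//.
- apply: eq_integral => y _.
  by rewrite -iterSr !EFinM cumulative_roof_integral ge0_muleDr// lee_fin cumulative_ge0.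
- by move=> y _; rewrite lee_fin mulr_ge0// cumulative_ge0.
- apply/measurable_EFinP; apply: measurable_funM => //.
    exact: measurableT_comp (mkT n) T_measurable.
  exact: measurableT_comp (mXS n) T_measurable.
- by move=> y _; rewrite mule_ge0// lee_fin.
- by apply: emeasurable_funM => //; apply/measurable_EFinP.
Qed.

Let sum_crossing_mean N : \sum_(0 <= n < N) crossing_mean n = boundary_mean N.
Proof.
elim: N => [|N ih].
  rewrite big_geq// /boundary_mean.
  under eq_integral do rewrite birkhoff_sum0 cumulative0 mulr0.
  by rewrite integral0.
rewrite big_nat_recr; last exact: leq0n.
rewrite ih; exact: esym (boundary_meanS N).
Qed.

(** The partial sums are boundary means.  Those of index N are eventually constant:
S_N(y) >= N inf r is beyond the support of chi(. - v), so that X(S_N(y)) is the whole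
integral of chi, and the mean of k(T^N y) does not depend on N. *)
Lemma mean_return_series M : (forall x, M < `|x| -> chi x = 0)%R -> (M <= v)%R ->
  \sum_(0 <= n <oo) crossing_mean n =
  \int[lebesgue_measure]_u (chi u)%:E * \int[mu]_y (k y)%:E.
Proof.
move=> hM Mv; apply/cvg_lim => //.
apply: cvg_near_cst; exists (Num.truncn ((v + M) / rho)).+1 => // N /= hN.
rewrite sum_crossing_mean /boundary_mean.
rewrite -(@invariant_integral_iter N (fun y => (k y)%:E)); last 2 first.
- exact/measurable_EFinP.
- by move=> y; rewrite lee_fin.
rewrite -ge0_integralZl//; last 3 first.
- exact/measurable_EFinP.
- by move=> y _; rewrite lee_fin.
- by apply: integral_ge0 => u _; rewrite lee_fin.
apply: eq_integral => y _; rewrite EFinM muleC; congr (_ * _).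
apply: (cumulative_large chi_ge0 hM Mv).
apply: lt_le_trans (birkhoff_sum_ge T r_gt0 N y).
rewrite -mulr_natl -ltr_pdivrMr//.
by apply: lt_le_trans (truncnS_gt _) _; rewrite ler_nat.
Qed.

Variable nu : probability X R.
Hypothesis nu_suspension : is_suspension_measure mu nu.

Lemma mean_campbell_hitting M : (forall x, M < `|x| -> chi x = 0)%R -> (M <= v)%R ->
  \int[nu]_x (campbell chi F (shift_measure v (P x)))%:E =
  (\int[mu]_y (r y)%:E)^-1 *
  (\int[lebesgue_measure]_u (chi u)%:E * \int[mu]_y (k y)%:E).
Proof.
move=> hM Mv; rewrite nu_suspension.
- congr (_ * _); rewrite -(mean_return_series hM Mv) -integral_nneseries//.
  + apply: eq_integral => y _.
    transitivity (\int[lebesgue_measure]_(s in `[0%R, r y[)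
       \sum_(0 <= n <oo) (k (iter n.+1 T y) * chi (S n.+1 y - s - v))%:E).
      apply: eq_integral => s /set_mem; rewrite /= in_itv/= => sry.
      case: insubP => [x _ xE|]; last by rewrite /= sry.
      rewrite /= campbell_hitting//; apply: eq_eseriesr => n _.
      by rewrite /visit_time xE.
    have mchis n : measurable_fun `[0%R, r y[ (fun s => (chi (S n.+1 y - s - v))%:E).
      apply: measurable_funTS; apply/measurable_EFinP.
      apply: (measurableT_comp (measurable_test chi)).
      by apply: measurable_funB => //; exact: measurable_funB.
    rewrite integral_nneseries//.
    * apply: eq_eseriesr => n _; rewrite /roof_integral -ge0_integralZl_EFin//.
        by move=> s _; rewrite lee_fin.
      exact: mchis.
    * move=> n; apply/measurable_EFinP; apply: measurable_funM => //.
      by apply/measurable_EFinP; exact: mchis.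
    * by move=> n s _; rewrite lee_fin mulr_ge0.
  + by move=> n; apply: emeasurable_funM => //; apply/measurable_EFinP; exact: mkT.
  + by move=> n y _; rewrite mule_ge0// lee_fin.
- exact: (measurable_campbell_hitting F_continuous F_ge0 F_restr chi_ge0
    T_measurable r_integrable D_measurable v).
- by move=> x; apply: Rintegral_ge0 => u _; rewrite mulr_ge0.
Qed.

End suspension_mean.

(** * Restriction to the positive half-line *)

Section positive_part.
Context {R : realType}.
Local Open Scope ring_scope.
Local Open Scope ereal_scope.
Local Notation lf := (lfmeasure R).
Local Notation pos := (`]0%R, +oo[%classic : set R).

(** The complement of E is negligible for the restricted measure. *)
Lemma ge0_integral_mrestr d (T : measurableType d) (m : {measure set T -> \bar R})
    (E : set T) (mE : measurable E) (h : T -> \bar R) :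
  measurable_fun setT h -> (forall x, 0 <= h x) ->
  \int[mrestr m mE]_x h x = \int[m]_(x in E) h x.
Proof.
move=> mh h0; rewrite -(setUv E) ge0_integral_setU//; last 3 first.
- exact: measurableC.
- by rewrite setUv.
- by rewrite disj_set2E setICr.
rewrite (eq_measure_integral m); last first.
  by move=> A mA AE; rewrite /= /mrestr setIidl.
rewrite [X in _ + X](eq_measure_integral mzero); last first.
  move=> A mA AE; rewrite /= /mrestr (_ : A `&` E = set0) ?measure0//.
  by apply/seteqP; split => // x [/AE].
by rewrite integral_measure_zero adde0.
Qed.

Let mpos : measurable (pos : set (measurableTypeR R)).
Proof. exact: measurable_itv. Qed.

Lemma lf_pos_compact (z : lf) (K : set R) : compact K -> mrestr z mpos K < +oo.
Proof.
move=> cK; apply: le_lt_trans (lfm_compact z cK).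
have mK : measurable (K : set (measurableTypeR R)) by exact: compact_measurable.
by rewrite /mrestr; apply: le_measure; rewrite ?inE//; exact: measurableI.
Qed.

Definition lf_pos (z : lf) : lf := LFMeasure (lf_pos_compact z).

Lemma lf_posE z (A : set R) : A `<=` [set t | (0 < t)%R] -> lf_pos z A = z A.
Proof.
move=> A0; rewrite /= /mrestr setIidl// => t /A0.
by rewrite /= in_itv/= andbT.
Qed.

Lemma Rintegral_lf_pos z (j : nat * nat * nat) :
  (\int[lf_pos z]_t tent j t)%:E = \int[z]_(t in pos) (tent j t)%:E.
Proof.
rewrite -(@ge0_integral_mrestr _ _ z _ mpos); last 2 first.
- by apply/measurable_EFinP; exact: (measurable_test (tent_test j)).
- by move=> t; rewrite lee_fin tent_ge0.
rewrite /Rintegral fineK//; apply: integrable_fin_num => //.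
exact: (integrable_test (lf_pos z) (tent_test j)).
Qed.

(** These test functions only see the positive half-line and increase with n to the
restriction of the tent to it. *)
Definition pos_test (j : nat * nat * nat) (n : nat) : test_function R :=
  test_mul (tent_test j) (@continuous_ramp R n).

Lemma cvg_pos_test z j : vague_pairing z (pos_test j n) @[n --> \oo] -->
  (\int[lf_pos z]_t tent j t)%R.
Proof.
have mt := measurable_test (tent_test j) : measurable_fun [set: measurableTypeR R] (tent j).
have h := @cvg_integral_ray R z 0 (tent j) mt (@tent_ge0 R j).
suff : (vague_pairing z (pos_test j n))%:E @[n --> \oo] -->
    (\int[lf_pos z]_t tent j t)%:E by move=> /fine_cvgP[].
rewrite Rintegral_lf_pos; apply: cvg_trans h; apply: near_eq_cvg; apply: nearW => n /=.
rewrite /vague_pairing /Rintegral fineK.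
  by apply: eq_integral => t _ /=; rewrite subr0 mulrC.
by apply: integrable_fin_num => //; exact: (integrable_test z (pos_test j n)).
Qed.

Lemma pos_test_nd z j : nondecreasing_seq (fun n => vague_pairing z (pos_test j n)).
Proof.
move=> n m nm; apply: le_Rintegral => //.
- exact: (integrable_test z (pos_test j n)).
- exact: (integrable_test z (pos_test j m)).
- by move=> t _; rewrite /= ler_wpM2l ?tent_ge0// le_ramp.
Qed.

Lemma measurable_lf_pos : measurable_fun [set: lf] lf_pos.
Proof.
apply: measurable_fun_lf => j.
apply: measurable_fun_cvg => [n|z _]; last exact: cvg_pos_test.
by apply: continuous_lf_measurable => z; exact: vague_pairing_continuous.
Qed.

(** A continuous approximation from below of the indicator of the measures whose
restriction to the positive half-line is in [tent_gt s].  The same n drives the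
cut-off at 0 and the steepness of the ramps, so that the approximation is monotone
in n. *)
Definition smooth_gt (n : nat) (s : seq ((nat * nat * nat) * R)) (z : lf) : R :=
  (\prod_(p <- s) ramp n (vague_pairing z (pos_test p.1 n) - p.2))%R.

Lemma smooth_gt_continuous n s : continuous (smooth_gt n s).
Proof.
elim: s => [|p s ih].
  rewrite (_ : smooth_gt n [::] = cst 1%R); first exact: cst_continuous.
  by apply/funext => z; rewrite /smooth_gt big_nil.
rewrite (_ : smooth_gt n (p :: s) = fun z =>
  (ramp n (vague_pairing z (pos_test p.1 n) - p.2) * smooth_gt n s z)%R); last first.
  by apply/funext => z; rewrite /smooth_gt big_cons.
move=> z.
have hp := @vague_pairing_continuous R (pos_test p.1 n) z.
have c1 : {for z, continuous (fun z : lf => vague_pairing z (pos_test p.1 n) - p.2)%R}.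
  exact: (cvgB hp (cvg_cst _)).
exact: (cvgM (continuous_comp c1 (@continuous_ramp R n _)) (ih z)).
Qed.

Lemma smooth_gt_ge0 n s z : (0 <= smooth_gt n s z)%R.
Proof. by apply: prodr_ge0 => p _; exact: ramp_ge0. Qed.

Lemma smooth_gt_le1 n s z : (smooth_gt n s z <= 1)%R.
Proof.
rewrite /smooth_gt; elim: s => [|p s ih]; first by rewrite big_nil.
rewrite big_cons; apply: mulr_ile1; rewrite ?ramp_ge0 ?ramp_le1//.
exact: smooth_gt_ge0.
Qed.

Lemma smooth_gt_restr n s (z1 z2 : lf) : (forall A : set R, measurable A ->
  A `<=` [set t | (0 < t)%R] -> z1 A = z2 A) -> smooth_gt n s z1 = smooth_gt n s z2.
Proof.
move=> z12; apply: eq_bigr => p _; congr (ramp n (_ - _)).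
rewrite /vague_pairing.
have E (z : lf) : (\int[z]_t pos_test p.1 n t = \int[z]_(t in pos) pos_test p.1 n t)%R.
  rewrite [RHS]Rintegral_mkcond; apply: eq_Rintegral => t _; rewrite patchE.
  case: ifPn => // /negP tpos; rewrite /= ramp0 ?mulr0// leNgt; apply/negP => t0.
  by apply: tpos; apply/mem_set; rewrite /= in_itv/= t0.
rewrite !E /Rintegral; congr fine; apply: eq_measure_integral => A mA Apos.
by apply: z12 => // t /Apos; rewrite /= in_itv/= andbT.
Qed.

Lemma smooth_gt_nd s z : nondecreasing_seq (fun n => smooth_gt n s z).
Proof.
move=> n m nm; apply: ler_prod => p _; rewrite ramp_ge0/=.
by apply: le_ramp => //; rewrite lerD2r; exact: pos_test_nd.
Qed.

Lemma cvg_ramp_mono (a : nat -> R) (l c : R) : nondecreasing_seq a ->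
  a n @[n --> \oo] --> l ->
  ramp n (a n - c) @[n --> \oo] --> (((c < l)%R : nat)%:R : R).
Proof.
move=> nda al.
have le_l n : (a n <= l)%R.
  rewrite -(cvg_lim _ al)//; apply: nondecreasing_cvgn_le => //.
  by apply/cvg_ex; exists l.
have [cl|lc] := ltP c l; last first.
  apply: cvg_near_cst; apply: nearW => n.
  by rewrite ramp0// subr_le0 (le_trans (le_l n)).
have e0 : (0 < (l - c) / 2)%R by rewrite divr_gt0// subr_gt0.
apply: cvg_near_cst.
have h1 := ramp_near1 e0.
have h2 : \forall n \near \oo, (`|l - a n| < (l - c) / 2)%R.
  exact: (cvgrPdist_lt _ _).1 al _ e0.
apply: filterS2 h1 h2 => n r1 an.
apply/eqP; rewrite eq_le ramp_le1/= -[leLHS]r1 le_ramp//.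
by move: an; rewrite ltr_norml; lra.
Qed.

Lemma cvg_smooth_gt s z : smooth_gt n s z @[n --> \oo] --> (\1_(tent_gt s) (lf_pos z) : R).
Proof.
have H p : ramp n (vague_pairing z (pos_test p.1 n) - p.2) @[n --> \oo] -->
    (((p.2 < \int[lf_pos z]_t tent p.1 t)%R : nat)%:R : R).
  by apply: cvg_ramp_mono; [exact: pos_test_nd|exact: cvg_pos_test].
elim: s => [|p s ih].
  rewrite (_ : \1_(tent_gt [::]) (lf_pos z) = 1%R :> R); last first.
    by rewrite indicE mem_set// => p.
  rewrite (_ : (fun n => smooth_gt n [::] z) = cst 1%R); first exact: cvg_cst.
  by apply/funext => n; rewrite /smooth_gt big_nil.
rewrite (_ : (fun n => smooth_gt n (p :: s) z) = fun n =>
  (ramp n (vague_pairing z (pos_test p.1 n) - p.2) * smooth_gt n s z)%R); last first.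
  by apply/funext => n; rewrite /smooth_gt big_cons.
rewrite (_ : \1_(tent_gt (p :: s)) (lf_pos z) =
  ((p.2 < \int[lf_pos z]_t tent p.1 t)%R : nat)%:R * \1_(tent_gt s) (lf_pos z))%R.
  exact: cvgM.
rewrite !indicE -natrM mulnb; congr ((_ : bool)%:R)%R.
apply/idP/andP => [/set_mem h|[h1 /set_mem h2]].
  split; first by apply: h; rewrite inE eqxx.
  by apply/mem_set => q qs; apply: h; rewrite inE qs orbT.
by apply/mem_set => q; rewrite inE => /predU1P[->//|/h2].
Qed.

End positive_part.

(** * Palm averages of the stationary extension *)

Section palm_of_extension.
Context {R : realType}.
Local Open Scope ring_scope.
Local Open Scope ereal_scope.
Local Notation lf := (lfmeasure R).
Variables (d : measure_display) (Y : measurableType d) (mu : probability Y R).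
Variable T : Y -> Y.
Hypothesis T_measurable : measurable_fun [set: Y] T.
Hypothesis T_invariant : forall A : set Y, measurable A -> mu (T @^-1` A) = mu A.
Variable r : Y -> R.
Hypothesis r_integrable : mu.-integrable [set: Y] (EFin \o r).
Hypothesis r_gt0 : (0 < inf (range r))%R.
Variable D : set Y.
Hypothesis D_measurable : measurable D.
Variable nu : probability (suspension r_gt0) R.
Hypothesis nu_suspension : is_suspension_measure mu nu.
Variables (d1 : measure_display) (Om1 : measurableType d1) (P1 : probability Om1 R).
Variable xi : Om1 -> lf.
Hypothesis xi_measurable : measurable_fun [set: Om1] xi.
Hypothesis xi_extension : is_stationary_extension nu
  (fun x => hitting_process T D x : lf) P1 xi.

Let rbar : R := fine (\int[mu]_y (r y)%:E).

Let rbarE : \int[mu]_y (r y)%:E = rbar%:E.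
Proof. by rewrite /rbar fineK//; exact: integrable_fin_num. Qed.

Let rbar_gt0 : (0 < rbar)%R.
Proof.
rewrite -lte_fin -rbarE.
apply: (@lt_le_trans _ _ (\int[mu]_y (cst (inf (range r))%:E y))).
  by rewrite integral_cst//= probability_setT mule1.
apply: ge0_le_integral => //.
- by move=> y _; rewrite lee_fin ltW.
- exact: measurable_int r_integrable.
- by move=> y _; rewrite lee_fin roof_ge.
Qed.

Section one_functional.
Variable F : lf -> R.
Hypothesis F_continuous : continuous F.
Hypothesis F_ge0 : forall z, (0 <= F z)%R.
Hypothesis F_le1 : forall z, (F z <= 1)%R.
Hypothesis F_restr : forall z1 z2 : lf, (forall A : set R, measurable A ->
  A `<=` [set t | (0 < t)%R] -> z1 A = z2 A) -> F z1 = F z2.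
Local Notation k := (return_weight T r_gt0 D F).

Definition mean_return : R := fine (\int[mu]_y (k y)%:E).

Let k0 y : (0 <= k y)%R.
Proof. exact: return_weight_ge0. Qed.

Let mk : measurable_fun setT k.
Proof.
exact: (measurable_return_weight r_gt0 F_continuous T_measurable r_integrable D_measurable).
Qed.

Lemma mean_returnE : \int[mu]_y (k y)%:E = mean_return%:E.
Proof.
rewrite /mean_return fineK// ge0_fin_numE; last first.
  by apply: integral_ge0 => y _; rewrite lee_fin.
apply: (@le_lt_trans _ _ (\int[mu]_y (cst 1 y))); last first.
  by rewrite integral_cst//= probability_setT mule1 ltry.
apply: ge0_le_integral => //.
- by move=> y _; rewrite lee_fin.
- exact/measurable_EFinP.
- by move=> y _; rewrite lee_fin return_weight_le1.
Qed.

Let c : R := (rbar^-1 * mean_return)%R.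

(** Convergence in distribution applies to bounded continuous functionals only,
hence the truncations G m of the Campbell functional.  On the hitting process they
coincide with it once m exceeds the uniform bound C, so that all the limits are equal,
and the truncations of the limit increase to the Campbell functional of xi. *)
Lemma mean_campbell_extension (chi : test_function R) : (forall u, 0 <= chi u)%R ->
  \int[P1]_w (campbell chi F (xi w))%:E =
  c%:E * \int[lebesgue_measure]_u (chi u)%:E.
Proof.
move=> chi0.
have [M M0 hM] := test_supp chi.
have [C hC] := campbell_bounded T r_gt0 D F_continuous F_ge0 F_le1 F_restr chi0.
pose I : R := (\int[lebesgue_measure]_u chi u)%R.
have IE : \int[lebesgue_measure]_u (chi u)%:E = I%:E.
  rewrite /I /Rintegral fineK//; apply: integrable_fin_num => //.
  exact: integrable_test lebesgue_lf chi.
have camp0 z : (0 <= campbell chi F z)%R.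
  by apply: Rintegral_ge0 => u _; rewrite mulr_ge0.
have mcamp : measurable_fun setT (fun w => campbell chi F (xi w)).
  apply: measurableT_comp xi_measurable.
  by apply: continuous_lf_measurable => z; exact: campbell_continuous.
pose G (m : nat) (z : lf) : R := Num.min (campbell chi F z) m%:R.
have Gc m : continuous (G m).
  move=> z; apply: (@continuous_min R lf (campbell chi F) (fun=> m%:R) z).
    exact: campbell_continuous.
  exact: cst_continuous.
have G0 m z : (0 <= G m z)%R by rewrite /G le_min camp0 ler0n.
have Gm m z : (G m z <= m%:R)%R by rewrite /G ge_min lexx orbT.
have mG m : measurable_fun setT (fun w => G m (xi w)).
  exact: measurableT_comp (continuous_lf_measurable (Gc m)) xi_measurable.
have Gmean m : (C <= m%:R)%R -> \int[P1]_w (G m (xi w))%:E = (c * I)%:E.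
  move=> Cm.
  have GI : P1.-integrable setT (fun w => (G m (xi w))%:E).
    apply: (le_integrable measurableT _ _ (finite_measure_integrable_cst P1 m%:R measurableT)).
      exact/measurable_EFinP.
    by move=> w _; rewrite /= lee_fin !ger0_norm.
  have Gb : exists K : R, forall z, (`|G m z| <= K)%R.
    by exists m%:R => z; rewrite ger0_norm.
  have lim := xi_extension (Gc m) Gb.
  (* from v = M on, the integrals are constant *)
  have lim2 : (\int[nu]_x G m (shift_measure u (hitting_process T D x)) @[u --> +oo] --> c * I)%R.
    apply: cvg_near_cst; exists M; split; first exact: num_real.
    move=> v /ltW Mv /=.
    rewrite /Rintegral; under eq_integral.
      move=> x _; rewrite /G (min_idPl _); last exact: le_trans (hC x v) Cm.
      over.
    rewrite (mean_campbell_hitting T_measurable T_invariant r_integrable D_measurable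
      F_continuous F_ge0 F_restr chi0 nu_suspension hM Mv).
    rewrite rbarE mean_returnE IE inver gt_eqF// -!EFinM /= /c.
    by rewrite (mulrC I) mulrA.
  have := cvg_unique _ lim lim2; rewrite /Rintegral => h.
  rewrite -[LHS]fineK; last exact: integrable_fin_num.
  by congr EFin; exact: h.
rewrite IE -EFinM.
have cv : \int[P1]_w (G m (xi w))%:E @[m --> \oo] --> \int[P1]_w (campbell chi F (xi w))%:E.
  apply: cvg_integral_mono => //.
  - by move=> m; apply/measurable_EFinP.
  - by move=> m w; rewrite lee_fin.
  - by move=> w n m nm; rewrite lee_fin /G le_min2// ler_nat.
  - move=> w _; apply: cvg_near_cst.
    exists (Num.truncn (campbell chi F (xi w))).+1 => // m /= hm.
    rewrite /G (min_idPl _)//; apply: le_trans (ltW (truncnS_gt _)) _.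
    by rewrite ler_nat.
apply: cvg_unique cv _ => //; apply: cvg_near_cst.
exists (Num.truncn C).+1 => // m /= hm; apply: Gmean.
by apply: le_trans (ltW (truncnS_gt _)) _; rewrite ler_nat.
Qed.

Lemma mean_shift_extension (A : set R) : measurable A ->
  \int[P1]_w \int[xi w]_(u in A) (F (shift_measure u (xi w)))%:E =
  c%:E * lebesgue_measure A.
Proof.
move=> mA.
exact: (mean_shift_integral F_continuous F_ge0 xi_measurable mean_campbell_extension mA).
Qed.

End one_functional.

Lemma intensity_extension :
  intensity P1 xi = (rbar^-1)%:E * mu D.
Proof.
have := @mean_shift_extension (fun=> 1%R) (@cst_continuous _ _ _) (fun=> ler01)
  (fun=> lexx _) (fun _ _ _ => erefl) `]0%R, 1%R]%classic (measurable_itv _).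
rewrite /intensity lebesgue_measure_itv/= lte_fin ltr01 oppr0 adde0 mule1 EFinM.
rewrite -mean_returnE//; last exact: cst_continuous.
under eq_integral do rewrite integral_cst// mul1e.
move=> ->; congr (_ * _).
rewrite /return_weight; under eq_integral do rewrite mulr1.
by rewrite integral_indic// setIT.
Qed.

Hypothesis D_gt0 : 0 < mu D.
Variable B : set R.
Hypothesis B_measurable : measurable B.
Hypothesis B_gt0 : 0 < lebesgue_measure B.
Hypothesis B_fin : lebesgue_measure B < +oo.

(** The numerator and the intensity are both instances of [mean_shift_extension],
the latter for F = 1 and the interval ]0, 1]. *)
Lemma palm_extension (F : lf -> R) : continuous F ->
  (forall z, 0 <= F z)%R -> (forall z, F z <= 1)%R ->
  (forall z1 z2 : lf, (forall A : set R, measurable A ->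
    A `<=` [set t | (0 < t)%R] -> z1 A = z2 A) -> F z1 = F z2) ->
  palm P1 xi B F =
  (mu D)^-1 * \int[mu]_(y in D) (F (hitting_process T D (base r_gt0 y)))%:E.
Proof.
move=> cF F0 F1 FR; rewrite /palm intensity_extension mean_shift_extension//.
have -> : \int[mu]_(y in D) (F (hitting_process T D (base r_gt0 y)))%:E = (mean_return F)%:E.
  rewrite -mean_returnE// integral_mkcond; apply: eq_integral => y _.
  rewrite patchE /return_weight indicE; case: ifPn => _; first by rewrite mul1r.
  by rewrite mul0r.
have muDfin : mu D \is a fin_num by exact: fin_num_measure.
have Bfin : lebesgue_measure B \is a fin_num by rewrite ge0_fin_numE// measure_ge0.
move: D_gt0 B_gt0; rewrite -(fineK muDfin) -(fineK Bfin) !lte_fin => D0 B0.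
rewrite -!EFinM !inver !gt_eqF ?mulr_gt0 ?invr_gt0// -!EFinM; congr EFin.
field; rewrite !gt_eqF//.
Qed.

End palm_of_extension.

(** * Equality of laws on the positive half-line *)

Section positive_part_law.
Context {R : realType}.
Local Open Scope ring_scope.
Local Open Scope ereal_scope.
Local Notation lf := (lfmeasure R).

Lemma lf_pos_integer_valued (z : intmeasure R) : lf_pos z \in integer_valued.
Proof.
rewrite inE => A mA.
have /set_mem := valP z; apply.
by apply: measurableI => //; exact: measurable_itv.
Qed.

Definition int_pos (z : intmeasure R) : intmeasure R :=
  exist (fun zeta => zeta \in integer_valued) _ (lf_pos_integer_valued z).

Lemma measurable_intmeasure_val :
  measurable_fun [set: intmeasure R] (@intmeasure_val R).
Proof. by move=> _ A mA; rewrite setTI; exists A => //; rewrite setTI. Qed.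

Lemma measurable_fun_intmeasure d (Z : measurableType d) (h : Z -> intmeasure R) :
  measurable_fun setT (fun x => h x : lf) -> measurable_fun setT h.
Proof.
move=> mh _ _ [A mA <-]; rewrite !setTI -comp_preimage.
by rewrite -[X in measurable X]setTI; exact: mh.
Qed.

Lemma measurable_int_pos : measurable_fun [set: intmeasure R] int_pos.
Proof.
apply: measurable_fun_intmeasure.
exact: measurableT_comp measurable_lf_pos measurable_intmeasure_val.
Qed.

Definition int_tent_gt (s : seq ((nat * nat * nat) * R)) : set (intmeasure R) :=
  [set z | tent_gt s z].

(** The sigma-algebra of integer-valued measures is the trace of that of locally
finite measures. *)
Lemma intmeasure_measurableE : @measurable _ (intmeasure R) = <<s range int_tent_gt >>.
Proof.
transitivity (preimage_set_system setT (@intmeasure_val R) (@measurable _ lf)) => //.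
rewrite lf_measurableE -[LHS]g_sigma_preimageE; congr (<<s _ >>).
apply/seteqP; split => [_ [_ [s _ <-] <-]|_ [s _ <-]].
  by exists s => //; rewrite setTI.
by exists (tent_gt s); [exists s|rewrite setTI].
Qed.

Lemma int_tent_gtI : setI_closed (range int_tent_gt).
Proof.
move=> _ _ [s _ <-] [t _ <-].
have [u _ uE] := @tent_gtI R _ _ (imageP _ Logic.I : range tent_gt (tent_gt s))
  (imageP _ Logic.I : range tent_gt (tent_gt t)).
exists u => //; rewrite /int_tent_gt uE.
by apply/seteqP; split.
Qed.

(** The hypothesis passes to the limit in n and says that the laws of the two
restrictions to the positive half-line agree on a generating pi-system. *)
Lemma ge0_integral_int_pos_eq d1 (Z1 : measurableType d1) (m1 : {measure set Z1 -> \bar R})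
    d2 (Z2 : measurableType d2) (m2 : {measure set Z2 -> \bar R})
    (z1 : Z1 -> intmeasure R) (z2 : Z2 -> intmeasure R) (f : intmeasure R -> R) :
  measurable_fun setT z1 -> measurable_fun setT z2 -> m1 setT < +oo ->
  (forall n s, \int[m1]_x (smooth_gt n s (z1 x))%:E = \int[m2]_x (smooth_gt n s (z2 x))%:E) ->
  measurable_fun [set: intmeasure R] f -> (forall z, 0 <= f z)%R ->
  \int[m1]_x (f (int_pos (z1 x)))%:E = \int[m2]_x (f (int_pos (z2 x)))%:E.
Proof.
move=> mz1 mz2 m1fin m12 mf f0.
have mp1 := measurableT_comp measurable_int_pos mz1.
have mp2 := measurableT_comp measurable_int_pos mz2.
have mEf : measurable_fun [set: intmeasure R] (EFin \o f) by exact/measurable_EFinP.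
have push d (Z : measurableType d) (m : {measure set Z -> \bar R}) (z : Z -> intmeasure R)
    (mp : measurable_fun setT (int_pos \o z)) :
    \int[m]_x (f (int_pos (z x)))%:E = \int[pushforward m (int_pos \o z)]_z (f z)%:E.
  rewrite (ge0_integral_pushforward mp m measurableT mEf) ?preimage_setT//.
  by move=> y _; rewrite lee_fin.
rewrite !push//; apply: eq_measure_integral => A mA _.
have lim d (Z : measurableType d) (m : {measure set Z -> \bar R}) (z : Z -> intmeasure R) s :
    measurable_fun setT z ->
    \int[m]_x (smooth_gt n s (z x))%:E @[n --> \oo] -->
    m ((int_pos \o z) @^-1` int_tent_gt s).
  move=> mz; have mp := measurableT_comp measurable_int_pos mz.
  have mS : measurable ((int_pos \o z) @^-1` int_tent_gt s).
    rewrite -[X in measurable X]setTI; apply: mp => //.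
    by rewrite intmeasure_measurableE; apply: sub_sigma_algebra; exists s.
  rewrite [X in _ --> X](_ : _ =
    \int[m]_x (\1_((int_pos \o z) @^-1` int_tent_gt s) x)%:E); last first.
    by rewrite integral_indic// setIT.
  apply: cvg_integral_mono => //.
  - move=> n; apply/measurable_EFinP.
    apply: (measurableT_comp (continuous_lf_measurable (@smooth_gt_continuous R n s))).
    exact: measurableT_comp measurable_intmeasure_val mz.
  - by move=> n x; rewrite lee_fin smooth_gt_ge0.
  - by move=> x n k nk; rewrite lee_fin smooth_gt_nd.
  - move=> x _; apply: cvg_EFin; first exact: nearW.
    exact: (@cvg_smooth_gt R s (z x)).
apply: (measure_unique (range int_tent_gt) (fun=> setT)) => //.
- exact: intmeasure_measurableE.
- exact: int_tent_gtI.
- by move=> _; exists [::] => //; apply/seteqP; split => // z _ p.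
- by rewrite bigcup_const//; exists 0%N.
- move=> _ [s _ <-].
  have := lim _ _ m2 z2 s mz2; under eq_fun do rewrite -m12.
  exact: cvg_unique (lim _ _ m1 z1 s mz1).
Qed.

End positive_part_law.

Unset Implicit Arguments.
Set Strict Implicit.
Set Printing Implicit Defensive.

Theorem proposition3 (R : realType)
    (* the base dynamics, the roof function and the target set *)
    (d : measure_display) (Y : measurableType d) (mu : probability Y R)
    (T : Y -> Y)
    (T_measurable : measurable_fun [set: Y] T)
    (T_invariant : forall A : set Y, measurable A -> mu (T @^-1` A) = mu A)
    (r : Y -> R)
    (r_integrable : mu.-integrable [set: Y] (EFin \o r))
    (r_gt0 : (0 < inf (range r))%R)
    (D : set Y) (D_measurable : measurable D) (D_gt0 : 0 < mu D)
    (* the invariant probability measure of the suspension semi-flow *)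
    (nu : probability (suspension r_gt0) R)
    (nu_suspension : is_suspension_measure mu nu)
    (* the stationary extension of the hitting process *)
    (d1 : measure_display) (Om1 : measurableType d1) (P1 : probability Om1 R)
    (xi : Om1 -> lfmeasure R)
    (xi_measurable : measurable_fun [set: Om1] xi)
    (xi_extension : is_stationary_extension nu
       (fun x => hitting_process T D x : lfmeasure R) P1 xi)
    (* a point process distributed according to the Palm distribution of xi *)
    (d2 : measure_display) (Om2 : measurableType d2) (P2 : probability Om2 R)
    (eta : Om2 -> intmeasure R)
    (eta_measurable : measurable_fun [set: Om2] eta)
    (B : set R) (B_measurable : measurable B)
    (B_gt0 : 0 < lebesgue_measure B) (B_fin : lebesgue_measure B < +oo)
    (eta_palm : forall g : lfmeasure R -> R,
       measurable_fun [set: lfmeasure R] g -> (forall zeta, (0 <= g zeta)%R) ->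
       \int[P2]_w (g (eta w))%:E = palm P1 xi B g)
    (f : intmeasure R -> R)
    (f_measurable : measurable_fun [set: intmeasure R] f)
    (f_ge0 : forall zeta, (0 <= f zeta)%R)
    (f_restriction : forall zeta1 zeta2 : intmeasure R,
       (forall A : set R, measurable A -> A `<=` [set t | (0 < t)%R] ->
          zeta1 A = zeta2 A) ->
       f zeta1 = f zeta2) :
  \int[P2]_w (f (eta w))%:E =
  (mu D)^-1 * \int[mu]_(y in D) (f (hitting_process T D (base r_gt0 y)))%:E.
Proof.
have f_pos z : f z = f (int_pos z).
  by apply: f_restriction => A mA A0; rewrite [RHS]lf_posE.
have muD_fin : mu D \is a fin_num by exact: fin_num_measure.
have c_ge0 : (0 <= (fine (mu D))^-1)%R by rewrite invr_ge0 fine_ge0.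
have cE : (mu D)^-1 = ((fine (mu D))^-1)%:E.
  by rewrite -{1}(fineK muD_fin) inver gt_eqF// fine_gt0// D_gt0 ltey_eq muD_fin.
pose P y : intmeasure R := hitting_process T D (base r_gt0 y).
have mP : measurable_fun setT P.
  apply: measurable_fun_intmeasure.
  exact: (measurable_hitting_base r_gt0 T_measurable r_integrable D_measurable).
pose m2 := mscale (NngNum c_ge0) (mrestr mu D_measurable).
have m2E (h : Y -> R) : measurable_fun setT h -> (forall y, 0 <= h y)%R ->
    \int[m2]_y (h y)%:E = (mu D)^-1 * \int[mu]_(y in D) (h y)%:E.
  move=> mh h0; rewrite ge0_integral_mscale//; last 2 first.
  - exact/measurable_EFinP.
  - by move=> y _; rewrite lee_fin.
  rewrite cE; congr (_ * _); apply: ge0_integral_mrestr.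
  - exact/measurable_EFinP.
  - by move=> y; rewrite lee_fin.
rewrite -m2E//; last exact: measurableT_comp f_measurable mP.
under eq_integral do rewrite f_pos.
under [RHS]eq_integral do rewrite f_pos.
apply: (ge0_integral_int_pos_eq eta_measurable mP) => //.
  by apply: le_lt_trans (probability_le1 P2 measurableT) _; rewrite ltry.
move=> n s; rewrite m2E; last 2 first.
- apply: (measurableT_comp (continuous_lf_measurable (@smooth_gt_continuous R n s))).
  exact: measurableT_comp (@measurable_intmeasure_val R) mP.
- by move=> y; exact: smooth_gt_ge0.
rewrite eta_palm; last 2 first.
- exact: continuous_lf_measurable (@smooth_gt_continuous R n s).
- exact: smooth_gt_ge0.
exact: (palm_extension T_measurable T_invariant r_integrable D_measurable
  nu_suspension xi_measurable xi_extension D_gt0 B_measurable B_gt0 B_fin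
  (@smooth_gt_continuous R n s) (smooth_gt_ge0 n s) (smooth_gt_le1 n s)
  (@smooth_gt_restr R n s)).
Qed.
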